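(* If $G$ is an indifference graph with associated Hessenberg function $\mathbf{m}$, then \[ \mathrm{LLT}(G)=\sum_{\sigma\leq \mathbf{m}}(q-1)^{n-\ell(\lambda(\sigma))}q^{\mathrm{wt}_G(\sigma)}e_{\lambda(\sigma)}. \] In particular, $\mathrm{LLT}(G)=\sum_{\lambda\vdash n}(q-1)^{n-\ell(\lambda)}c_\lambda(G)e_{\lambda}$, where $c_{\lambda}(G)\in \mathbb{N}[q]$.
   Context: A Hessenberg function is a non-decreasing $\mathbf{m}\colon[n]\to[n]$ with $\mathbf{m}(i)\geq i$; its indifference graph $G=G_{\mathbf{m}}$ has vertex set $[n]$ and edges $\{i,j\}$ with $i<j\leq \mathbf{m}(i)$. The unicellular LLT polynomial is $\mathrm{LLT}(G)=\sum_{\kappa}q^{\mathrm{asc}_G(\kappa)}x_\kappa$, summing over all (not necessarily proper) colorings $\kappa\colon[n]\to\mathbb{N}$, where $x_\kappa=\prod_v x_{\kappa(v)}$ and $\mathrm{asc}_G(\kappa)=|\{(i,j): i<j,\ \kappa(i)<\kappa(j),\ \{i,j\}\in E(G)\}|$. For $\sigma\in S_n$, $\sigma\leq\mathbf{m}$ means $\sigma(i)\leq\mathbf{m}(i)$ for all $i$; $\lambda(\sigma)$ is the cycle type and $\ell$ denotes length of a partition; $\sigma^c$ is the word obtained by writing $\sigma$ in cycle notation (each cycle starting with its least element, cycles ordered by least element) and erasing parentheses. A $G$-inversion of a word $\tau$ is a pair of positions $i<j$ with $\tau(i)>\tau(j)$ and $\{\tau(i),\tau(j)\}\in E(G)$;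 $\mathrm{wt}_G(\sigma)$ is the number of $G$-inversions of $\sigma^c$. $c_\lambda(G)=\sum_{\sigma\leq\mathbf{m},\ \lambda(\sigma)=\lambda}q^{\mathrm{wt}_G(\sigma)}$. *)

(* Defs.v *)
From HB Require Import structures.
From mathcomp Require Import all_boot all_order all_algebra all_fingroup.
From mathcomp Require Import finmap multiset.
From mathcomp Require Import boolp classical_sets functions cardinality fsbigop.

Set Implicit Arguments.
Unset Strict Implicit.
Unset Printing Implicit Defensive.
Import GRing.Theory Num.Theory.

Local Open Scope classical_set_scope.
Local Open Scope ring_scope.

(* The monomial prod_i x_i ^ (a i) is the finite multiset a of its indices, so
   the product of monomials is the sum [msetD] of multisets. *)
Definition monom := multiset nat.

(* Formal power series in x_0, x_1, x_2, ... over Z[q], given by their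
   coefficients; q is 'X : {poly int}.  The regular module {poly int}^o makes
   [*:] the coefficientwise scaling by Z[q].  The product of series is
   [series_mul], and not the pointwise product of functions. *)
Definition series := monom -> {poly int}^o.

HB.instance Definition _ :=
  GRing.Lmodule.copy series (monom -> {poly int}^o).

(* sum_(i in D) (c i) x^(mon i), for a possibly infinite family in which every
   monomial occurs finitely many times. *)
Definition formal_sum (I : choiceType) (D : set I)
    (c : I -> {poly int}) (mon : I -> monom) : series :=
  fun a => \sum_(i \in D `&` [set i | mon i = a]) c i.

Definition series_one : series := fun a => (a == mset0)%:R.

Definition series_mul (f g : series) : series :=
  fun a => \sum_(p \in [set p : monom * monom | msetD p.1 p.2 = a])
             f p.1 * g p.2.

(* e_k = sum over i_1 < ... < i_k of x_(i_1) ... x_(i_k). *)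
Definition elem (k : nat) : series :=
  formal_sum [set A : {fset nat} | #|` A|%fset = k]
    (fun=> 1) (fun A => seq_mset (enum_fset A)).

Definition elem_part (la : seq nat) : series :=
  foldr series_mul series_one [seq elem k | k <- la].

Section Graph.
Variable n : nat.

Definition Hessenberg (m : 'I_n -> 'I_n) : Prop :=
  (forall i j : 'I_n, (i <= j)%N -> (m i <= m j)%N) /\
  (forall i : 'I_n, (i <= m i)%N).

Definition indiff_graph (m : 'I_n -> 'I_n) : rel 'I_n :=
  fun i j => (i < j <= m i)%N || (j < i <= m j)%N.

Definition asc (G : rel 'I_n) (kappa : 'I_n -> nat) : nat :=
  #|[set p : 'I_n * 'I_n |
      [&& (p.1 < p.2)%N, (kappa p.1 < kappa p.2)%N & G p.1 p.2]]%SET|.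

Definition LLT (G : rel 'I_n) : series :=
  formal_sum [set: {ffun 'I_n -> nat}]
    (fun kappa => 'X^(asc G kappa)) (fun kappa => seq_mset (codom kappa)).

Definition cycle_type (s : 'S_n) : seq nat :=
  sort geq [seq #|C| | C : {set 'I_n} in porbits s].

(* [enum 'I_n] is increasing, so the cycles come in the order of their least
   elements, each being written (i, s i, s (s i), ...). *)
Definition cycle_word (s : 'S_n) : seq 'I_n :=
  flatten [seq traject s i #|porbit s i|
          | i <- enum 'I_n & [forall j in porbit s i, (i <= j)%N]].

Definition inversions (G : rel 'I_n) (w : seq 'I_n) : nat :=
  #|[set p : 'I_(size w) * 'I_(size w) |
      let a := tnth (in_tuple w) p.1 in let b := tnth (in_tuple w) p.2 in
      [&& (p.1 < p.2)%N, (b < a)%N & G a b]]%SET|.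

Definition wt (G : rel 'I_n) (s : 'S_n) : nat := inversions G (cycle_word s).

Definition perm_le (s : 'S_n) (m : 'I_n -> 'I_n) : bool :=
  [forall i, (s i <= m i)%N].

Definition is_partition (la : seq nat) : bool :=
  [&& sorted geq la, 0%N \notin la & sumn la == n].

Definition c_coef (m : 'I_n -> 'I_n) (la : seq nat) : {poly int} :=
  \sum_(s : 'S_n | perm_le s m && (cycle_type s == la))
     'X^(wt (indiff_graph m) s).

End Graph.

(* The infinite sums above are [\sum_(i \in _) _], which is only meaningful for
   finitely many nonzero terms; this is the case in every use. *)

Lemma finite_colorings n (a : monom) :
  finite_set [set kappa : {ffun 'I_n -> nat} | seq_mset (codom kappa) = a].
Proof.
pose g (f : {ffun 'I_n -> finsupp a}) : {ffun 'I_n -> nat} :=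
  [ffun i => val (f i)].
apply: (@sub_finite_set _ _ (g @` [set: {ffun 'I_n -> finsupp a}])); last first.
  exact/finite_image/finite_finset.
move=> k /= ka.
have kin i : k i \in finsupp a.
  by rewrite -ka mem_finsupp mset_seqE -lt0n -has_count has_pred1 codom_f.
by exists [ffun i => [` kin i]%fset] => //; apply/ffunP => i; rewrite !ffunE.
Qed.

Lemma finite_fset_monom (a : monom) :
  finite_set [set A : {fset nat} | seq_mset (enum_fset A) = a].
Proof.
apply: (@sub_finite_set _ _ [set finsupp a]); last exact: finite_set1.
move=> A /= <-; apply/fsetP => i.
by rewrite mem_finsupp mset_seqE -lt0n -has_count has_pred1.
Qed.

Lemma finite_splittings (a : monom) :
  finite_set [set p : monom * monom | msetD p.1 p.2 = a].
Proof.
pose N := (\max_(i <- finsupp a) a i)%N.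
pose g (f : {ffun finsupp a -> 'I_N.+1}) : monom :=
  [fsfun i : finsupp a => nat_of_ord (f i) | 0%N].
pose D := g @` [set: {ffun finsupp a -> 'I_N.+1}].
have finD : finite_set D by exact/finite_image/finite_finset.
apply: (@sub_finite_set _ _ (D `*` D)); last exact: finite_setX.
have inD (b : monom) : (forall i, (b i <= a i)%N) -> D b.
  move=> ba; have bN i : i \in finsupp a -> (b i < N.+1)%N.
    by move=> ia; rewrite ltnS (leq_trans (ba i))// leq_bigmax_seq.
  exists [ffun i => Ordinal (bN _ (valP i))] => //.
  apply/fsfunP => i; rewrite /g fsfun_ffun; case: insubP => /= [u _ <-|ia].
    by rewrite ffunE.
  by have := ba i; rewrite (fsfun_dflt ia) leqn0 => /eqP.
move=> [b c] /= bca; split; apply: inD => i /=; rewrite -bca msetE2.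
  exact: leq_addr.
exact: leq_addl.
Qed.

Lemma finite_partitions n : finite_set [set la : seq nat | is_partition n la].
Proof.
pose g (t : {bseq n of 'I_n.+1}) := [seq nat_of_ord i | i <- t].
apply: (@sub_finite_set _ _ (g @` [set: {bseq n of 'I_n.+1}])); last first.
  exact/finite_image/finite_finset.
move=> la /and3P[_ la0 /eqP lan].
have le_sumn (s : seq nat) i : i \in s -> (i <= sumn s)%N.
  elim: s => //= j s IH; rewrite inE => /predU1P[->|/IH]; first exact: leq_addr.
  by move=> /leq_trans; apply; exact: leq_addl.
have sz : (size [seq inord i : 'I_n.+1 | i <- la] <= n)%N.
  rewrite size_map -lan; elim: la la0 {lan} => //= i la IH.
  rewrite inE negb_or => /andP[i0 /IH]; rewrite eq_sym -lt0n in i0.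
  by move=> h; rewrite -add1n leq_add.
exists (Bseq sz) => //; rewrite /g /= -map_comp map_id_in// => i ila /=.
by rewrite inordK// ltnS -lan le_sumn.
Qed.

(* Main.v *)
From HB Require Import structures.
Require Import Defs.
From mathcomp Require Import all_boot all_order all_algebra all_fingroup.
From mathcomp Require Import zify ring.

(** The cycles with a given support [X] that respect [m] contribute a product
    [block_wt X], so the right-hand side, as a function [S] of the vertex set and
    of the sequence of the [e_k], is characterized by a recursion on the support
    [X] of the cycle of the least vertex.  It then suffices to show that adding a variable [u] to the
    alphabet, which turns [e_k] into [e_k + u * e_(k-1)], changes [S Y] into
    [sum_C u^|C| q^(cross (Y - C) C) S (Y - C)], since this is how the colorings
    behave when [C] is the set of the vertices with the largest color.  Through
    the recursion this becomes an identity between the weights [block_wt], which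
    says that a block and a color class can be exchanged.  That identity follows
    from the symmetry of the two-color sums [sum_A q^(cross A (Y - A)) t^|A|],
    because [sum_X (-1)^|Y - X| q^(cross X (Y - X)) block_wt X] only depends on
    [|Y|]. *)

(** A block and a color class cannot be exchanged term by term: [cross] is oriented, and removing
    the two sets in the other order turns edges from X to Y - X into edges from Y - X to X. Only the
    sums over all subsets agree. The interval structure of the graph enters there, through the
    deletion of a longest edge.

    The factor q - 1 carried by each non-initial element of a cycle acts twice. When a cycle is read
    from its least element, [m] bounds each next element by the current one, and with q - 1 at every
    step the sum over the reading orders telescopes; hence the product form of [block_wt]. In the
    alternating sum, the subsets with and without the largest vertex then combine into minus the
    summand of the smaller vertex set, with the empty subset as the only exception.

    The sequence E stays arbitrary in the recursion so that variables can be added one at a time,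
    starting from none, where both sides vanish on every nonempty vertex set. *)

Set Implicit Arguments.
Unset Strict Implicit.
Unset Printing Implicit Defensive.
Import GRing.Theory.
Local Open Scope ring_scope.

(** * Two-color sums *)

Section SubsetSums.
Variables (T : finType) (V : nmodType).
Implicit Types (A X Y Z C : {set T}).

Lemma sum_subset_setU1 x Y (F : {set T} -> V) : x \notin Y ->
  \sum_(A : {set T} | A \subset x |: Y) F A =
  \sum_(A : {set T} | A \subset Y) F A +
  \sum_(A : {set T} | A \subset Y) F (x |: A).
Proof.
move=> xY; rewrite (bigID (fun A : {set T} => x \in A)) /= addrC; congr (_ + _).
  apply: eq_bigl => A; apply/andP/idP => [[sAY xA]|sAY].
    apply/subsetP => y yA; have := subsetP sAY _ yA.
    by rewrite !inE => /predU1P[yx|//]; rewrite -yx yA in xA.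
  by rewrite (subset_trans sAY (subsetUr _ _)); split=> //; apply: contra xY; apply/subsetP.
rewrite (reindex_onto (fun A => x |: A) (fun A => A :\ x)) /=; last first.
  by move=> A /andP[_ xA]; rewrite setD1K.
apply: eq_bigl => A; rewrite setU11 andbT.
apply/andP/idP => [[sA /eqP eA]|sA].
  have xA : x \notin A by rewrite -eA !inE eqxx.
  by rewrite -eA -(setU1K xY) setSD.
split; first exact: setUS.
by rewrite setU1K //; apply: contra xY; apply/subsetP.
Qed.

Lemma sum_subset_setD Y (F : {set T} -> V) :
  \sum_(A : {set T} | A \subset Y) F A =
  \sum_(A : {set T} | A \subset Y) F (Y :\: A).
Proof.
rewrite (reindex_onto (fun A => Y :\: A) (fun A => Y :\: A)) /=; last first.
  by move=> A sA; rewrite setDDr setDv set0U; apply/setIidPr.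
apply: eq_bigl => A; rewrite subsetDl /= setDDr setDv set0U.
by apply/eqP/idP => [<-|/setIidPr //]; rewrite subsetIl.
Qed.

(** Ordered pairs of disjoint subsets X, C are indexed by their union Z and by X. *)
Lemma sum_subset_subset Y (F : {set T} -> {set T} -> V) :
  \sum_(X : {set T} | X \subset Y) \sum_(C : {set T} | C \subset Y :\: X) F X C =
  \sum_(Z : {set T} | Z \subset Y) \sum_(X : {set T} | X \subset Z) F X (Z :\: X).
Proof.
rewrite [RHS](exchange_big_dep (fun X : {set T} => X \subset Y)) /=; last first.
  by move=> Z X sZ sX; apply: subset_trans sX sZ.
apply: eq_bigr => X sX.
have UD Z : X :|: (Z :\: X) = X :|: Z.
  by apply/setP => y; rewrite !inE; case: (y \in X).
rewrite (reindex_onto (fun Z => Z :\: X) (fun C => X :|: C)) /=; last first.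
  move=> C; rewrite subsetD => /andP[_ dCX].
  by rewrite setDUl setDv set0U; apply/setDidPl.
apply: eq_bigl => Z; apply/andP/andP => [[sZ /eqP eZ]|[sZ sX']].
  rewrite UD in eZ.
  have sXZ : X \subset Z by rewrite -eZ subsetUl.
  split=> //; rewrite -(setID Z X) subUset (subset_trans (subsetIr _ _) sX).
  exact: subset_trans sZ (subsetDl _ _).
by rewrite setSD // UD; split=> //; apply/eqP/setUidPr.
Qed.

End SubsetSums.

Section CrossEdges.
Variable n : nat.
Implicit Types (e : rel 'I_n) (A B C X Y Z D : {set 'I_n}).

Definition cross e A B : nat := (\sum_(x in A) \sum_(y in B) e x y)%N.

Lemma cross0l e B : cross e set0 B = 0%N.
Proof. by rewrite /cross big_set0. Qed.

Lemma cross0r e A : cross e A set0 = 0%N.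
Proof. by rewrite /cross big1 // => x _; rewrite big_set0. Qed.

Lemma crossUl e A B C : [disjoint A & B] ->
  cross e (A :|: B) C = (cross e A C + cross e B C)%N.
Proof.
rewrite disjoint_sym => /setDidPl dBA.
by rewrite /cross (big_setID A) /= setUK setDUl setDv set0U dBA.
Qed.

Lemma crossUr e A B C : [disjoint B & C] ->
  cross e A (B :|: C) = (cross e A B + cross e A C)%N.
Proof.
rewrite disjoint_sym => /setDidPl dCB; rewrite /cross -big_split /=.
apply: eq_bigr => x _.
by rewrite (big_setID B) /= setUK setDUl setDv set0U dCB.
Qed.

Lemma cross1l e x B : cross e [set x] B = (\sum_(y in B) e x y)%N.
Proof. by rewrite /cross big_set1. Qed.

Lemma cross1r e A y : cross e A [set y] = (\sum_(x in A) e x y)%N.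
Proof. by rewrite /cross; apply: eq_bigr => x _; rewrite big_set1. Qed.

Lemma crossU1l e x A C : x \notin A ->
  cross e (x |: A) C = (cross e [set x] C + cross e A C)%N.
Proof. by move=> xA; rewrite crossUl // disjoints1. Qed.

Lemma crossU1r e A y C : y \notin C ->
  cross e A (y |: C) = (cross e A [set y] + cross e A C)%N.
Proof. by move=> yC; rewrite crossUr // disjoints1. Qed.

Lemma cross_eq0 e A B : (forall x y, x \in A -> y \in B -> e x y = false) ->
  cross e A B = 0%N.
Proof.
by move=> h; rewrite /cross big1 // => x xA; rewrite big1 // => y yB; rewrite h.
Qed.

Lemma eq_cross e e' A B : (forall x y, x \in A -> y \in B -> e x y = e' x y) ->
  cross e A B = cross e' A B.
Proof.
by move=> h; apply: eq_bigr => x xA; apply: eq_bigr => y yB; rewrite h.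
Qed.

(* The ascending edges of an indifference graph on [Y]. *)
Definition interval_rel e Y := forall i j, i \in Y -> j \in Y -> e i j ->
  (i < j)%N /\ forall k, k \in Y -> (i < k < j)%N -> e i k && e k j.

Lemma interval_relS e X Y : X \subset Y -> interval_rel e Y -> interval_rel e X.
Proof.
move=> /subsetP sXY h i j /sXY iY /sXY jY /(h _ _ iY jY)[ij hk].
by split=> // k /sXY; apply: hk.
Qed.

End CrossEdges.

Lemma ltn_sub_same_start (i j k : nat) :
  (i < k -> k - i <= j - i -> k != j -> k < j)%N.
Proof. lia. Qed.

Lemma ltn_sub_same_end (i j k : nat) :
  (k < j -> j - k <= j - i -> k != i -> i < k)%N.
Proof. lia. Qed.

Section TwoColors.
Variables (n : nat) (R : comNzRingType) (q : R).
Implicit Types (e : rel 'I_n) (A B C X Y Z D : {set 'I_n}) (r : nat -> R).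

Definition two_color e Y r : R :=
  \sum_(A : {set 'I_n} | A \subset Y) q ^+ cross e A (Y :\: A) * r #|A|.

(* Deleting a longest edge (i, j): every vertex between i and j contributes
   exactly one ascent as soon as i and j get different colors. *)
Lemma two_color_del_edge e Y i j r : interval_rel e Y ->
    i \in Y -> j \in Y -> e i j ->
    (forall k l, k \in Y -> l \in Y -> e k l -> l - k <= j - i)%N ->
  two_color e Y r =
  two_color (fun k l => e k l && ((k, l) != (i, j))) Y r +
  (q - 1) * q ^+ (\sum_(k in Y :\ i :\ j) (i < k < j)) *
    two_color e (Y :\ i :\ j) (r \o succn).
Proof.
move=> he iY jY eij hmax; set e' := fun k l => _.
set Y0 := Y :\ i :\ j.
have [ltij hb] := he _ _ iY jY eij.
have neij : i != j by apply: contraTneq ltij => ->; rewrite ltnn.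
have sY0 : Y0 \subset Y by rewrite (subset_trans (subsetDl _ _)) ?subsetDl.
have iY0 : i \notin Y0 by rewrite !inE eqxx andbF.
have jY0 : j \notin Y0 by rewrite !inE eqxx.
have i_jY0 : i \notin j |: Y0 by rewrite in_setU1 negb_or neij.
have Yeq : Y = i |: (j |: Y0).
  by rewrite /Y0 setD1K ?setD1K // !inE eq_sym neij.
have cr A : A \subset Y ->
    cross e A (Y :\: A) =
    (cross e' A (Y :\: A) + ((i \in A) && (j \notin A)))%N.
  move=> sA; rewrite /cross.
  have -> : ((i \in A) && (j \notin A) : nat) =
    (\sum_(x in A) \sum_(y in Y :\: A) ((x, y) == (i, j)))%N.
    case: (boolP (i \in A)) => [iA|iA] /=; last first.
      rewrite big1 // => x xA; rewrite big1 // => y _; rewrite xpair_eqE.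
      by case: eqP => // xi; rewrite -xi xA in iA.
    rewrite (bigD1 i iA) /= [X in (_ + X)%N]big1 ?addn0; last first.
      by move=> x /andP[_ /negbTE xi]; rewrite big1 // => y _; rewrite xpair_eqE xi.
    case: (boolP (j \in A)) => jA /=.
      rewrite big1 // => y; rewrite inE => /andP[yA _].
      by rewrite xpair_eqE; case: (y =P j) yA => [->|]; rewrite ?jA ?andbF.
    rewrite (bigD1 j) /= ?inE ?jA // eqxx big1 ?addn0 // => y /andP[_ /negbTE yj].
    by rewrite xpair_eqE yj andbF.
  rewrite -big_split /=; apply: eq_bigr => x _; rewrite -big_split /=.
  apply: eq_bigr => y _; rewrite /e'.
  by case: eqP => [[-> ->]|]; rewrite ?eij ?andbT ?addn0.
(* Putting the edge (i, j) back multiplies a term by q exactly when i is in A and j is not, so it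
   adds q - 1 times that term. *)
transitivity (\sum_(A : {set 'I_n} | A \subset Y)
   (q ^+ cross e' A (Y :\: A) * r #|A| +
    ((i \in A) && (j \notin A))%:R * (q - 1) * q ^+ cross e' A (Y :\: A) * r #|A|)).
  apply: eq_bigr => A sA; rewrite cr //; case: (_ && _) => /=.
    by rewrite addn1 exprS; ring.
  by rewrite addn0; ring.
rewrite big_split /=; congr (_ + _).
rewrite {1}Yeq sum_subset_setU1 // big1 ?add0r; last first.
  move=> A sA; suff /negbTE -> : i \notin A by rewrite !mul0r.
  by apply: contra i_jY0; apply/subsetP.
rewrite sum_subset_setU1 // [X in _ + X]big1 ?addr0; last first.
  by move=> A sA; rewrite !inE !eqxx !orbT andbF !mul0r.
rewrite /two_color mulr_sumr; apply: eq_bigr => A sA.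
have iA : i \notin A by apply: contra iY0; apply/subsetP.
have jA : j \notin A by apply: contra jY0; apply/subsetP.
rewrite setU11 !inE eq_sym (negbTE neij) (negbTE jA) /= cardsU1 iA add1n /=.
have -> : Y :\: (i |: A) = j |: (Y0 :\: A).
  rewrite Yeq; apply/setP => x; rewrite !inE.
  case: (x =P i) => [->|_] /=; first by rewrite (negbTE neij) !andbF.
  by case: (x =P j) => [->|_] //=; rewrite jA.
rewrite crossU1l // !crossU1r ?inE ?eqxx ?andbF //.
have -> : cross e' [set i] [set j] = 0%N.
  by rewrite cross1l big_set1 /e' eqxx andbF.
have neqs k : k \in Y0 -> (k != i) && (k != j).
  by rewrite !inE => /and3P[-> ->].
have -> : cross e' A (Y0 :\: A) = cross e A (Y0 :\: A).
  apply: eq_cross => x y xA yA; rewrite /e' xpair_eqE.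
  by case: eqP xA => [->|]; rewrite ?(negbTE iA) ?andbT.
(* The interval property provides the edges from i and into j for every k in between; maximality of
   the length of (i, j) excludes all others. *)
have -> : (\sum_(k in Y0) (i < k < j) =
   cross e' [set i] (Y0 :\: A) + cross e' A [set j])%N.
  rewrite (big_setID A) /= addnC; congr (_ + _)%N.
    rewrite cross1l; apply: eq_bigr => k; rewrite inE => /andP[_ kY0].
    have /andP[ki kj] := neqs _ kY0; have kY := subsetP sY0 _ kY0.
    rewrite /e' xpair_eqE eqxx (negbTE kj) andbT; congr nat_of_bool.
    apply/idP/idP => [ikj|eik]; first by have /andP[] := hb k kY ikj.
    have [ik _] := he _ _ iY kY eik; rewrite ik /=.
    exact: ltn_sub_same_start ik (hmax _ _ iY kY eik) kj.
  rewrite cross1r (setIidPr sA); apply: eq_bigr => k kA.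
  have kY0 := subsetP sA _ kA.
  have /andP[ki kj] := neqs _ kY0; have kY := subsetP sY0 _ kY0.
  rewrite /e' xpair_eqE eqxx (negbTE ki) /= andbT; congr nat_of_bool.
  apply/idP/idP => [ikj|eik]; first by have /andP[] := hb k kY ikj.
  have [kj' _] := he _ _ kY jY eik; rewrite kj' andbT.
  exact: ltn_sub_same_end kj' (hmax _ _ kY jY eik) ki.
by rewrite !exprD; ring.
Qed.

(** Without edges, complementing A exchanges the two sides. Otherwise a longest edge is deleted, and
    both terms of [two_color_del_edge] fall under the induction on the number of edges plus the
    number of vertices. *)
Lemma two_color_sym e Y r : interval_rel e Y ->
  two_color e Y r = two_color e Y (fun k => r (#|Y| - k)%N).
Proof.
have [k] := ubnP (cross e Y Y + #|Y|)%N.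
elim: k => // k IHk in e Y r *; rewrite ltnS => hk he.
pose E := [pred p : 'I_n * 'I_n | [&& p.1 \in Y, p.2 \in Y & e p.1 p.2]].
have [p0 p0E|noe] := pickP E; last first.
  have noe2 A B : A \subset Y -> B \subset Y -> cross e A B = 0%N.
    move=> /subsetP sA /subsetP sB; apply: cross_eq0 => x y /sA xY /sB yY.
    by have := noe (x, y); rewrite /= xY yY.
  rewrite /two_color sum_subset_setD; apply: eq_bigr => A sA.
  have DA : Y :\: (Y :\: A) = A by rewrite setDDr setDv set0U; apply/setIidPr.
  by rewrite !noe2 ?DA ?subsetDl // cardsD (setIidPr sA).
case: (arg_maxnP (fun p : 'I_n * 'I_n => p.2 - p.1)%N p0E) => -[i j] /= /and3P[iY jY eij] hmax.
have {}hmax k1 l1 : k1 \in Y -> l1 \in Y -> e k1 l1 -> (l1 - k1 <= j - i)%N.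
  by move=> kY lY ekl; apply: (hmax (k1, l1)); rewrite /= kY lY.
rewrite !(two_color_del_edge _ he iY jY eij hmax).
have [ltij hb] := he _ _ iY jY eij.
have neij : i != j by apply: contraTneq ltij => ->; rewrite ltnn.
set Y0 := Y :\ i :\ j; set e' := fun _ _ => _.
have cY : #|Y| = #|Y0|.+2.
  by rewrite (cardsD1 i) iY (cardsD1 j) !inE eq_sym neij jY.
have sY0 : Y0 \subset Y by rewrite (subset_trans (subsetDl _ _)) ?subsetDl.
congr (_ + _ * _).
  apply: IHk.
    have lt1 : (cross e' Y Y < cross e Y Y)%N.
      rewrite /cross (bigD1 i iY) /= [X in (_ < X)%N](bigD1 i iY) /= -addSn.
      apply: leq_add.
        rewrite (bigD1 j jY) /= [X in (_ < X)%N](bigD1 j jY) /= -addSn.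
        rewrite /e' eqxx andbF eij; apply: leq_add => //.
        by apply: leq_sum => y _; case: (e i y); rewrite ?leq_b1.
      by apply: leq_sum => x _; apply: leq_sum => y _; rewrite /e'; case: (e x y); rewrite ?leq_b1.
    by apply: leq_trans hk; rewrite ltn_add2r.
  move=> k1 l1 kY lY /andP[ekl nkl]; have [kl hb'] := he _ _ kY lY ekl.
  split=> // z zY kzl; have /andP[e1 e2] := hb' z zY kzl; rewrite /e' e1 e2 /= !xpair_eqE.
  (* The deleted edge cannot be one of the two edges required here, since (k1, l1) would then be
     longer than a longest edge. *)
  have := hmax _ _ kY lY ekl.
  case/andP: kzl => kz zl; apply: contraTT.
  rewrite negb_and !negbK -ltnNge => /orP[]/andP[/eqP<- /eqP<-].
    by rewrite ltn_sub2r // (ltn_trans kz).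
  by rewrite ltn_sub2l // (ltn_trans kz).
rewrite IHk; last 2 first.
- rewrite cY in hk; apply: leq_trans hk; rewrite addnS ltnS leq_add //.
  rewrite /cross [X in (_ <= X)%N](big_setID Y0) /= (setIidPr sY0).
  apply: leq_trans (leq_addr _ _); apply: leq_sum => x _.
  by rewrite [X in (_ <= X)%N](big_setID Y0) /= (setIidPr sY0) leq_addr.
- exact: interval_relS he.
(* One of the two removed vertices lies in A and the other does not, so the shift of [r] by one
   commutes with the reflection. *)
rewrite /two_color; apply: eq_bigr => A sA /=; congr (_ * r _).
by rewrite cY subSS subSn // subset_leq_card.
Qed.

End TwoColors.

(** * Block weights *)

Lemma sum_subset_exchange (T : finType) (V : nmodType) (Y : {set T})
    (F : {set T} -> {set T} -> V) :
  \sum_(D : {set T} | D \subset Y) \sum_(X : {set T} | X \subset Y :\: D) F D X =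
  \sum_(X : {set T} | X \subset Y) \sum_(D : {set T} | D \subset Y :\: X) F D X.
Proof.
rewrite (exchange_big_dep (fun X : {set T} => X \subset Y)) /=; last first.
  by move=> D X _ /subset_trans; apply; apply: subsetDl.
apply: eq_bigr => X sX; apply: eq_bigl => D.
by rewrite !subsetD sX /= disjoint_sym.
Qed.

Lemma setD_subK (T : finType) (X Y : {set T}) : X \subset Y -> Y :\: (Y :\: X) = X.
Proof. by move=> sXY; rewrite setDDr setDv set0U; apply/setIidPr. Qed.

Lemma setD_disjoint (T : finType) (X Y : {set T}) : [disjoint X & Y :\: X].
Proof. by rewrite -setI_eq0 setIDA setIC -setIDA setDv setI0. Qed.

Lemma setD_split (T : finType) (X Y D : {set T}) :
  X \subset Y -> D \subset Y :\: X -> Y :\: D = X :|: ((Y :\: X) :\: D).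
Proof.
move=> sX sD; apply/setP => x.
have /implyP := subsetP sX x; have /implyP := subsetP sD x; rewrite !inE.
by case: (x \in X); case: (x \in Y); case: (x \in D).
Qed.

Lemma setD_chain (T : finType) (X W Y : {set T}) :
  X \subset W -> W \subset Y -> Y :\: X = (W :\: X) :|: (Y :\: W).
Proof.
move=> sX sW; apply/setP => x.
have /implyP := subsetP sX x; have /implyP := subsetP sW x; rewrite !inE.
by case: (x \in X); case: (x \in Y); case: (x \in W).
Qed.

(** Both sides run over the ordered partitions of Y into three parts D, X, C, with D chosen first on
    the left and C chosen first on the right. *)
Lemma sum_subset_rotate (T : finType) (V : nmodType) (Y : {set T})
    (F : {set T} -> {set T} -> {set T} -> V) :
  \sum_(D : {set T} | D \subset Y)
    \sum_(X : {set T} | X \subset Y :\: D) F D X ((Y :\: D) :\: X) =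
  \sum_(C : {set T} | C \subset Y)
    \sum_(X : {set T} | X \subset Y :\: C) F ((Y :\: C) :\: X) X C.
Proof.
under eq_bigr do rewrite sum_subset_setD.
transitivity (\sum_(D : {set T} | D \subset Y)
    \sum_(C : {set T} | C \subset Y :\: D) F D ((Y :\: D) :\: C) C).
  apply: eq_bigr => D _; apply: eq_bigr => C sC.
  by rewrite setD_subK.
rewrite sum_subset_exchange; apply: eq_bigr => C sC.
rewrite sum_subset_setD; apply: eq_bigr => X sX.
congr (F _ _ _); set D := _ :\: X.
by rewrite setDDl setUC -setDDl setD_subK.
Qed.

Lemma set_max_ind n (P : {set 'I_n} -> Prop) : P set0 ->
    (forall (z : 'I_n) (Y : {set 'I_n}), (forall x, x \in Y -> (x < z)%N) ->
       P Y -> P (z |: Y)) ->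
  forall Y, P Y.
Proof.
move=> P0 PU Y; have [k] := ubnP #|Y|; elim: k => // k IHk in Y *.
have [->//|[x0 x0Y]] := set_0Vmem Y; rewrite ltnS => hY.
case: (arg_maxnP (fun x : 'I_n => x : nat) x0Y) => z zY zmax.
have {}zY : z \in Y := zY.
rewrite -(setD1K zY); apply: PU.
  move=> x; rewrite !inE => /andP[xz xY].
  by rewrite ltn_neqAle xz; apply: zmax.
by apply: IHk; move: hY; rewrite (cardsD1 z) zY.
Qed.

Lemma set_min_case n (Y : {set 'I_n}) : Y = set0 \/
  exists (a : 'I_n) (Y' : {set 'I_n}), (forall x, x \in Y' -> (a < x)%N) /\ Y = a |: Y'.
Proof.
have [->|[x0 x0Y]] := set_0Vmem Y; [by left | right].
case: (arg_minnP (fun x : 'I_n => x : nat) x0Y) => z zY zmin.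
have {}zY : z \in Y := zY.
exists z, (Y :\ z); split; last by rewrite setD1K.
move=> x; rewrite !inE => /andP[xz xY].
by rewrite ltn_neqAle eq_sym xz; apply: zmin.
Qed.

Lemma lt_notin n (z : 'I_n) (Y : {set 'I_n}) :
  (forall x, x \in Y -> (x < z)%N) -> z \notin Y.
Proof. by move=> h; apply/negP => /h; rewrite ltnn. Qed.

Lemma gt_notin n (z : 'I_n) (Y : {set 'I_n}) :
  (forall x, x \in Y -> (z < x)%N) -> z \notin Y.
Proof. by move=> h; apply/negP => /h; rewrite ltnn. Qed.

Lemma setU1D_in (T : finType) (x : T) (X Y : {set T}) :
  x \notin Y -> (x |: Y) :\: (x |: X) = Y :\: X.
Proof.
move=> xY; apply/setP => y; rewrite !inE.
by case: eqP => // ->; rewrite (negbTE xY) andbF.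
Qed.

Lemma setU1D_notin (T : finType) (x : T) (X Y : {set T}) :
  x \notin X -> (x |: Y) :\: X = x |: (Y :\: X).
Proof.
move=> xX; apply/setP => y; rewrite !inE.
by case: eqP => // ->; rewrite xX.
Qed.

Section Blocks.
Variables (n : nat) (R : comNzRingType) (q : R) (e : rel 'I_n).
Hypothesis he : interval_rel e [set: 'I_n].
Implicit Types (A B C X Y Z D : {set 'I_n}) (r rho : nat -> R).

Let e_lt i j : e i j -> (i < j)%N.
Proof. by move=> /(he (in_setT _) (in_setT _))[]. Qed.

Lemma cross_above A B : (forall x y, x \in A -> y \in B -> (y <= x)%N) ->
  cross e A B = 0%N.
Proof.
move=> h; apply: cross_eq0 => x y xA yB; apply/negbTE/negP => /e_lt.
by rewrite ltnNge h.
Qed.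

Let he' Y : interval_rel e Y := interval_relS (subsetT Y) he.

(* [(q - 1) ^+ #|X|.-1] times the sum of [q ^+ inv] over the cycles with support
   [X], read from the least element of [X]. *)
Definition block_wt X : R := (X != set0)%:R *
  \prod_(x in X | [exists y in X, (y < x)%N]) (q ^+ cross e X [set x] - 1).

Lemma block_wt0 : block_wt set0 = 0.
Proof. by rewrite /block_wt eqxx mul0r. Qed.

Lemma block_wt1 x : block_wt [set x] = 1.
Proof.
rewrite /block_wt -cards_eq0 cards1 mul1r big1 // => y /andP[].
rewrite inE => /eqP-> /exists_inP[z]; rewrite inE => /eqP->.
by rewrite ltnn.
Qed.

(** No ascending edge leaves the largest vertex, so the other factors do not change. *)
Lemma block_wtU1_max (z : 'I_n) X : X != set0 -> (forall x, x \in X -> (x < z)%N) ->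
  block_wt (z |: X) = (q ^+ cross e X [set z] - 1) * block_wt X.
Proof.
move=> X0 hz; have zX := lt_notin hz.
have X0' : z |: X != set0 by apply/set0Pn; exists z; rewrite setU11.
rewrite /block_wt X0 X0' !mul1r (bigD1 z) /=; last first.
  rewrite setU11; have /set0Pn[x xX] := X0.
  by apply/exists_inP; exists x; [rewrite setU1r | apply: hz].
rewrite crossU1l // cross_above ?add0n; last first.
  by move=> x y; rewrite !inE => /eqP-> /eqP->.
congr (_ * _); apply: eq_big => [x|x /andP[/andP[xzX _] xz]].
  rewrite in_setU1; case: eqP => [->|/eqP xz] /=; first by rewrite (negbTE zX) andbF.
  rewrite andbT; case xX: (x \in X) => //=.
  apply/exists_inP/exists_inP => [[y]|[y yX yx]]; last by exists y => //; rewrite setU1r.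
  rewrite in_setU1 => /predU1P[->|yX yx]; last by exists y.
  by rewrite ltnNge ltnW // hz.
rewrite in_setU1 (negbTE xz) /= in xzX.
rewrite crossU1l // cross_above // => u v; rewrite !inE => /eqP-> /eqP->.
by rewrite ltnW // hz.
Qed.

(** A new least vertex changes many factors, so the induction removes the largest vertex z instead.
    If a and z are adjacent, then all vertices between them are adjacent to both, the two exponents
    equal #|X|, and the two factors are exchanged; if not, the factor of z is unaffected by a. *)
Lemma block_wtU1_min (a : 'I_n) X : X != set0 -> (forall x, x \in X -> (a < x)%N) ->
  block_wt (a |: X) = (q ^+ cross e [set a] X - 1) * block_wt X.
Proof.
elim/set_max_ind: X => [|z X hz IH] //; first by rewrite eqxx.
move=> _ ha; have az : (a < z)%N by apply: ha; rewrite setU11.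
have zX := lt_notin hz.
have a1 : [set a] != set0 by apply/set0Pn; exists a; rewrite inE.
have [->|X0] := eqVneq X set0.
  rewrite !setU0 setUC block_wtU1_max //; last by move=> x; rewrite inE => /eqP->.
  by rewrite !block_wt1.
have {}ha x : x \in X -> (a < x)%N by move=> xX; apply: ha; rewrite setU1r.
have aX := gt_notin ha.
rewrite setUCA block_wtU1_max; last 2 first.
- by apply/set0Pn; exists a; rewrite setU11.
- by move=> x; rewrite !inE => /predU1P[->//|/hz].
rewrite IH // block_wtU1_max // crossU1l // crossU1r //.
have -> : cross e [set a] [set z] = e a z by rewrite cross1l big_set1.
case eaz: (e a z) => /=; last by rewrite !add0n; ring.
have [_ hb] := he (in_setT _) (in_setT _) eaz.
suff [-> ->] : cross e [set a] X = #|X| /\ cross e X [set z] = #|X| by ring.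
rewrite cross1l cross1r -sum1_card.
by split; apply: eq_bigr => x xX;
  (have /andP[e1 e2] : e a x && e x z by apply: hb; rewrite ?in_setT // ha ?hz);
   rewrite ?e1 ?e2.
Qed.

(** This is (-1)^(k-1) k, the solution of kappa (k+1) = (-1)^k - kappa k with kappa 0 = 0. *)
Definition kappa k : R := k%:R * - (-1) ^+ k.

(** For the largest vertex z and c = [cross e X [set z]], the summand of X in Y is multiplied by
    -q^c if z stays outside and by q^c - 1 if z joins X, in total by -1. Only the empty X deviates,
    because [block_wt] is 0 on it but 1 on a singleton. *)
Lemma block_wt_alternating Y :
  \sum_(X : {set 'I_n} | X \subset Y)
    (-1) ^+ #|Y :\: X| * q ^+ cross e X (Y :\: X) * block_wt X = kappa #|Y|.
Proof.
elim/set_max_ind: Y => [|z Y hz IH].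
  rewrite (big_pred1 set0) => [|X]; last by rewrite subset0.
  by rewrite block_wt0 /kappa cards0 mulr0 mul0r.
have zY := lt_notin hz.
rewrite sum_subset_setU1 // -big_split /= cardsU1 zY add1n.
transitivity (\sum_(X : {set 'I_n} | X \subset Y)
  (- ((-1) ^+ #|Y :\: X| * q ^+ cross e X (Y :\: X) * block_wt X) +
   (X == set0)%:R * (-1) ^+ #|Y|)).
  apply: eq_bigr => X sX.
  have zX : z \notin X by apply: contra zY; apply/subsetP.
  have hX x : x \in X -> (x < z)%N by move/(subsetP sX)/hz.
  rewrite setU1D_notin // setU1D_in // cardsU1 !inE (negbTE zY) andbF add1n.
  rewrite crossU1r ?inE ?(negbTE zY) ?andbF // crossU1l //.
  rewrite [cross e [set z] _]cross_above ?add0n; last first.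
    by move=> u v; rewrite !inE => /eqP-> /andP[_ /hz/ltnW].
  have [->|X0] := eqVneq X set0.
    by rewrite setU0 setD0 block_wt0 block_wt1 !cross0l !mulr0 oppr0 mul1r !mulr1.
  rewrite block_wtU1_max // !exprD exprS mul0r addr0.
  by move: ((-1) ^+ _) => s; ring.
rewrite big_split /= sumrN IH (bigD1 set0) ?sub0set //= eqxx big1 ?addr0.
  rewrite /kappa exprS -addn1 natrD mulr1n; move: ((-1) ^+ _) => s; ring.
by move=> X /andP[_ /negbTE->]; rewrite mul0r.
Qed.

(* Both sides have the same image under the invertible transform
   [W |-> (Y |-> \sum_D (-1) ^+ #|D| * q ^+ cross e (Y :\: D) D * W (Y :\: D))]. *)
Lemma block_wt_swap Y rho :
  \sum_(X : {set 'I_n} | X \subset Y)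
    block_wt X * q ^+ cross e X (Y :\: X) * rho #|Y :\: X| =
  \sum_(X : {set 'I_n} | X \subset Y)
    block_wt X * q ^+ cross e (Y :\: X) X * rho #|Y :\: X|.
Proof.
have [k] := ubnP #|Y|; elim: k => // k IHk in Y *; rewrite ltnS => hk.
pose WL Y := \sum_(X : {set 'I_n} | X \subset Y)
    block_wt X * q ^+ cross e X (Y :\: X) * rho #|Y :\: X|.
pose WR Y := \sum_(X : {set 'I_n} | X \subset Y)
    block_wt X * q ^+ cross e (Y :\: X) X * rho #|Y :\: X|.
suff: \sum_(D : {set 'I_n} | D \subset Y)
         (-1) ^+ #|D| * q ^+ cross e (Y :\: D) D * WL (Y :\: D) =
      \sum_(D : {set 'I_n} | D \subset Y)
         (-1) ^+ #|D| * q ^+ cross e (Y :\: D) D * WR (Y :\: D).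
  (* The summand of the empty D is the wanted side itself; the others agree by induction and
     cancel. *)
  rewrite (bigD1 set0) ?sub0set //= [RHS](bigD1 set0) ?sub0set //=.
  rewrite setD0 cards0 cross0r !expr0 !mul1r => h.
  have := h; rewrite [X in _ + X](_ : _ = \sum_(i : {set 'I_n} | (i \subset Y) && (i != set0))
        (-1) ^+ #|i| * q ^+ cross e (Y :\: i) i * WR (Y :\: i)); first by move/addIr.
  apply: eq_bigr => D /andP[sD D0]; congr (_ * _); apply: IHk.
  apply: leq_trans hk; rewrite cardsD (setIidPr sD) ltn_subrL.
  by rewrite card_gt0 D0 (leq_trans _ (subset_leq_card sD)) ?card_gt0.
(* In both transforms Y is split into D, X and C. For [WR], fixing C and summing over X by
   [block_wt_alternating] leaves a two-color sum, which [two_color_sym] turns into this common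
   value. *)
transitivity (two_color q e Y (fun k => rho (#|Y| - k)%N * kappa k)); last first.
  rewrite two_color_sym //.
  transitivity (\sum_(C : {set 'I_n} | C \subset Y) q ^+ cross e C (Y :\: C) *
                   (rho #|C| * kappa #|Y :\: C|)).
    apply: eq_bigr => C sC; rewrite cardsD (setIidPr sC) subKn //.
    exact: subset_leq_card.
  pose F D X C := (-1) ^+ #|D| * q ^+ cross e (Y :\: D) D *
            (block_wt X * q ^+ cross e C X * rho #|C|).
  transitivity (\sum_(D : {set 'I_n} | D \subset Y)
      \sum_(X : {set 'I_n} | X \subset Y :\: D) F D X ((Y :\: D) :\: X));
      last by apply: eq_bigr => D _; rewrite mulr_sumr.
  rewrite sum_subset_rotate {}/F; apply: eq_bigr => C sC.
  rewrite -block_wt_alternating !mulr_sumr; apply: eq_bigr => X sX.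
  set D := (Y :\: C) :\: X.
  have -> : Y :\: D = C :|: X.
    by rewrite /D setDDl setD_subK // subUset sC (subset_trans sX (subsetDl _ _)).
  have dCX : [disjoint C & X].
    by move: sX; rewrite subsetD disjoint_sym => /andP[].
  have eYC : Y :\: C = X :|: D.
    by rewrite /D -{1}(setID (Y :\: C) X) (setIidPr sX).
  rewrite crossUl // eYC crossUr; last by rewrite /D setD_disjoint.
  by rewrite !exprD; ring.
transitivity (\sum_(D : {set 'I_n} | D \subset Y)
    \sum_(X : {set 'I_n} | X \subset Y :\: D)
      (-1) ^+ #|D| * q ^+ cross e (Y :\: D) D *
          (block_wt X * q ^+ cross e X ((Y :\: D) :\: X) * rho #|(Y :\: D) :\: X|)).
  by apply: eq_bigr => D _; rewrite mulr_sumr.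
rewrite sum_subset_exchange.
(* For [WL] the edges inside the complement of X run from C to D. With X fixed, the symmetry of the
   two colors reverses them; afterwards X can be summed out for fixed C. *)
transitivity (\sum_(X : {set 'I_n} | X \subset Y)
   block_wt X * q ^+ cross e X (Y :\: X) *
     two_color q e (Y :\: X) (fun k => (-1) ^+ k * rho (#|Y :\: X| - k)%N)).
  apply: eq_bigr => X sX; rewrite two_color_sym // /two_color.
  rewrite [in RHS]sum_subset_setD mulr_sumr; apply: eq_bigr => D sD.
  have cD : (#|Y :\: X| - #|(Y :\: X) :\: D|)%N = #|D|.
    by rewrite [in X in (_ - X)%N]cardsD (setIidPr sD) subKn // subset_leq_card.
  have cC : (#|Y :\: X| - #|D|)%N = #|(Y :\: X) :\: D|.
    by rewrite [RHS]cardsD (setIidPr sD).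
  rewrite cD cC setD_subK //.
  have -> : (Y :\: D) :\: X = (Y :\: X) :\: D by rewrite setDDl setUC -setDDl.
  rewrite (setD_split sX sD).
  set C := (Y :\: X) :\: D.
  have eZ : Y :\: X = D :|: C by rewrite /C -{1}(setID (Y :\: X) D) (setIidPr sD).
  have dDC : [disjoint D & C] by rewrite /C setD_disjoint.
  have dXC : [disjoint X & C].
    by rewrite disjoint_sym /C (disjointWl (subsetDl _ _)) // disjoint_sym setD_disjoint.
  rewrite crossUl // eZ crossUr // !exprD; ring.
transitivity (\sum_(C : {set 'I_n} | C \subset Y) q ^+ cross e (Y :\: C) C *
                 (rho #|C| * kappa #|Y :\: C|)); last first.
  rewrite /two_color [in RHS]sum_subset_setD; apply: eq_bigr => C sC.
  have -> : (#|Y| - #|Y :\: C|)%N = #|C|.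
    by rewrite cardsD (setIidPr sC) subKn ?subset_leq_card.
  by rewrite setD_subK.
pose F X D C := block_wt X * q ^+ cross e X (Y :\: X) *
          (q ^+ cross e D C * ((-1) ^+ #|D| * rho #|C|)).
transitivity (\sum_(X : {set 'I_n} | X \subset Y)
    \sum_(D : {set 'I_n} | D \subset Y :\: X) F X D ((Y :\: X) :\: D)).
  apply: eq_bigr => X sX; rewrite mulr_sumr; apply: eq_bigr => D sD.
  by rewrite /F [in RHS](cardsD _ D) (setIidPr sD).
rewrite sum_subset_rotate {}/F; apply: eq_bigr => C sC.
rewrite sum_subset_setD -block_wt_alternating !mulr_sumr; apply: eq_bigr => X sX.
rewrite setD_subK //; set D := (Y :\: C) :\: X.
have eZ : Y :\: C = X :|: D by rewrite /D -{1}(setID (Y :\: C) X) (setIidPr sX).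
have dXD : [disjoint X & D] by rewrite /D setD_disjoint.
have dDC : [disjoint D & C].
  by rewrite /D (disjointWl (subsetDl _ _)) // disjoint_sym setD_disjoint.
rewrite (setD_split sC sX) -/D setUC.
rewrite eZ crossUr // crossUl // !exprD; ring.
Qed.

(** This is [block_wt_swap] for a |: Z, split by whether X contains a. The sums over X without a
    cancel by [block_wt_swap] for Z, up to the part created by q^(cross a X) [block_wt] X =
    [block_wt] (a |: X) + [block_wt] X. The latter fails for the empty X, which accounts for the
    isolated term on the left. *)
Lemma block_wtU1_swap (a : 'I_n) Z rho : (forall x, x \in Z -> (a < x)%N) ->
  \sum_(X : {set 'I_n} | X \subset Z)
    block_wt (a |: X) * q ^+ cross e (a |: X) (Z :\: X) * rho #|Z :\: X| +
    rho #|Z|.+1 =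
  \sum_(X : {set 'I_n} | X \subset Z)
    block_wt (a |: X) * q ^+ cross e (Z :\: X) X *
      (rho #|Z :\: X| + rho #|Z :\: X|.+1).
Proof.
move=> ha; have aZ := gt_notin ha.
have := block_wt_swap (a |: Z) rho; rewrite !sum_subset_setU1 //.
have aX X : X \subset Z -> a \notin X by move=> sX; apply: contra aZ; apply/subsetP.
have aD X : a \notin Z :\: X by rewrite !inE (negbTE aZ) andbF.
have cr0 A : A \subset Z -> cross e A [set a] = 0%N.
  move=> /subsetP sA; apply: cross_above => x y /sA/ha/ltnW lax.
  by rewrite inE => /eqP->.
under eq_bigr => X sX.
  rewrite setU1D_notin ?aX // cardsU1 aD add1n crossU1r ?aD // cr0 // add0n; over.
rewrite (block_wt_swap Z (rho \o succn)) /=.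
under [X in _ + X = _]eq_bigr do rewrite setU1D_in //.
under [X in _ = _ + X]eq_bigr => X sX.
  rewrite setU1D_in // crossU1r ?aX // cr0 ?subsetDl // add0n; over.
under [X in _ = X + _]eq_bigr => X sX.
  rewrite setU1D_notin ?aX // cardsU1 aD add1n crossU1l // exprD.
  have -> : block_wt X * (q ^+ cross e [set a] X * q ^+ cross e (Z :\: X) X) * rho #|Z :\: X|.+1 =
     block_wt (a |: X) * q ^+ cross e (Z :\: X) X * rho #|Z :\: X|.+1 +
     (block_wt X * q ^+ cross e (Z :\: X) X * rho #|Z :\: X|.+1 -
     (X == set0)%:R * rho #|Z|.+1).
    have [->|X0] := eqVneq X set0.
      by rewrite setU0 block_wt0 block_wt1 setD0 !cross0r expr0 /=; ring.
    rewrite block_wtU1_min //; last by move=> x /(subsetP sX)/ha.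
    by rewrite mul0r; ring.
  over.
rewrite !big_split /= sumrN.
rewrite (_ : \sum_(X : {set 'I_n} | X \subset Z) (X == set0)%:R * rho #|Z|.+1 = rho #|Z|.+1).
  rewrite /= => h; under [RHS]eq_bigr do rewrite mulrDr.
  rewrite big_split /= -[X in X + _ = _](addKr (\sum_(X : {set 'I_n} | X \subset Z)
     block_wt X * q ^+ cross e (Z :\: X) X * rho #|Z :\: X|.+1)) h; ring.
rewrite (bigD1 set0) ?sub0set //= eqxx mul1r big1 ?addr0 //.
by move=> X /andP[_ /negbTE->]; rewrite mul0r.
Qed.

(** Here X is the support of the cycle of a, without a itself. The exponent counts the inversions
    between this cycle and the later ones; a adds none, being least. *)
Definition block_rec (E : nat -> R) (S : {set 'I_n} -> R) :=
  S set0 = 1 /\ forall (a : 'I_n) Y, (forall x, x \in Y -> (a < x)%N) ->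
  S (a |: Y) = \sum_(X : {set 'I_n} | X \subset Y)
    q ^+ cross e (Y :\: X) X * block_wt (a |: X) * E #|X|.+1 * S (Y :\: X).

(* [E' k = E k + u * E k.-1] is the effect on elementary symmetric functions of
   adding a variable [u]; the vertices of [C] are those getting this largest
   color. *)
Lemma block_rec_add_var E E' S S' u : block_rec E S -> block_rec E' S' ->
    E 0%N = 1 -> (forall k, E' k.+1 = E k.+1 + u * E k) ->
  forall Y, S' Y = \sum_(C : {set 'I_n} | C \subset Y)
    u ^+ #|C| * q ^+ cross e (Y :\: C) C * S (Y :\: C).
Proof.
move=> [S0 SU] [S0' SU'] E0 EE' Y.
have [k] := ubnP #|Y|; elim: k => // k IHk in Y *; rewrite ltnS => hk.
have [->|[a [Z [ha eY]]]] := set_min_case Y.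
  rewrite (big_pred1 set0) => [|X]; last by rewrite subset0.
  by rewrite setD0 cards0 cross0l S0 S0' !expr0 !mulr1.
have aZ := gt_notin ha.
have {IHk}IH X : X \subset Z -> S' X = \sum_(C : {set 'I_n} | C \subset X)
    u ^+ #|C| * q ^+ cross e (X :\: C) C * S (X :\: C).
  move=> sX; apply: IHk; apply: leq_trans hk.
  by rewrite eY cardsU1 aZ ltnS subset_leq_card.
have aX X : X \subset Z -> a \notin X by move=> sX; apply: contra aZ; apply/subsetP.
rewrite {}eY SU' // sum_subset_setU1 //.
(* W is the union of the color class and the block of a, without a. Everything outside the inner sum
   depends on W only. *)
transitivity (\sum_(W : {set 'I_n} | W \subset Z)
    q ^+ cross e (Z :\: W) W * S (Z :\: W) *
     (\sum_(X : {set 'I_n} | X \subset W)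
        block_wt (a |: X) * q ^+ cross e (W :\: X) X *
         (u ^+ #|W :\: X| * E #|X|.+1 + u ^+ #|W :\: X|.+1 * E #|X|))).
  transitivity (\sum_(X : {set 'I_n} | X \subset Z)
    \sum_(C : {set 'I_n} | C \subset Z :\: X)
    q ^+ cross e (Z :\: X) X * block_wt (a |: X) * E' #|X|.+1 *
      (u ^+ #|C| * q ^+ cross e (Z :\: X :\: C) C * S (Z :\: X :\: C))).
    by apply: eq_bigr => X sX; rewrite IH ?subsetDl // mulr_sumr.
  rewrite sum_subset_subset; apply: eq_bigr => W sW.
  rewrite mulr_sumr; apply: eq_bigr => X sX.
  have eW : X :|: (W :\: X) = W by rewrite -{2}(setID W X) (setIidPr sX).
  have dW : [disjoint X & W :\: X] by apply: setD_disjoint.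
  have -> : cross e (Z :\: W) W = (cross e (Z :\: W) X + cross e (Z :\: W) (W :\: X))%N.
    by rewrite -{2}eW crossUr.
  rewrite setDDl eW (setD_chain sX sW) crossUl; last first.
    by rewrite (disjointWl (subsetDl _ _)) // setD_disjoint.
  by rewrite !exprD exprS EE'; ring.
(* On this side the color class is removed first. The extra term u^(#|W|+1) is the case where a
   belongs to the color class, which is then a |: W. *)
symmetry; transitivity (\sum_(W : {set 'I_n} | W \subset Z)
    q ^+ cross e (Z :\: W) W * S (Z :\: W) *
     (\sum_(X : {set 'I_n} | X \subset W)
        block_wt (a |: X) * q ^+ cross e (a |: X) (W :\: X) *
         (u ^+ #|W :\: X| * E #|X|.+1) + u ^+ #|W|.+1)).
  under [RHS]eq_bigr do rewrite mulrDr.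
  rewrite big_split /=; congr (_ + _); last first.
    apply: eq_bigr => C sC; rewrite cardsU1 aX // add1n setU1D_in // crossU1r ?aX //.
    rewrite cross_above ?add0n; first by ring.
    by move=> x y; rewrite !inE => /andP[_ /ha/ltnW lax] /eqP->.
  transitivity (\sum_(C : {set 'I_n} | C \subset Z)
    \sum_(X : {set 'I_n} | X \subset Z :\: C)
    u ^+ #|C| * q ^+ cross e (a |: (Z :\: C)) C *
     (q ^+ cross e (Z :\: C :\: X) X * block_wt (a |: X) * E #|X|.+1 * S (Z :\: C :\: X))).
    apply: eq_bigr => C sC; rewrite setU1D_notin ?aX // SU ?mulr_sumr //.
    by move=> x; rewrite inE => /andP[_ /ha].
  rewrite sum_subset_exchange sum_subset_subset; apply: eq_bigr => W sW.
  rewrite mulr_sumr; apply: eq_bigr => X sX.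
  have eW : (W :\: X) :|: X = W by rewrite setUC -{2}(setID W X) (setIidPr sX).
  have dW : [disjoint X & W :\: X] by apply: setD_disjoint.
  have sDW : W :\: X \subset W by apply: subsetDl.
  have aWX : a \notin Z :\: (W :\: X) by rewrite !inE (negbTE aZ) andbF.
  rewrite crossU1l // (setD_chain sDW sW) setD_subK // setDUl.
  have -> : X :\: X = set0 by rewrite setDv.
  rewrite set0U.
  have -> : (Z :\: W) :\: X = Z :\: W by rewrite setDDl (setUidPl sX).
  rewrite crossUl; last by rewrite (disjointWl sX) // setD_disjoint.
  have -> : cross e (Z :\: W) W = (cross e (Z :\: W) X + cross e (Z :\: W) (W :\: X))%N.
    by rewrite -{2}eW crossUr 1?disjoint_sym // addnC.
  rewrite crossU1l ?(aX _ (subset_trans sX sW)) // !exprD; ring.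
apply: eq_bigr => W sW; congr (_ * _).
have haW x : x \in W -> (a < x)%N by move/(subsetP sW)/ha.
(* At c = #|W - X| this function is u^c E (#|X|+1), and at c + 1 it is u^(c+1) E #|X|: the two terms
   of E'. The isolated term carries E 0 = 1. *)
have := block_wtU1_swap (fun c => u ^+ c * E (#|W|.+1 - c)%N) haW.
rewrite subnn E0 mulr1 => h.
have cX X : X \subset W -> #|W| = (#|X| + #|W :\: X|)%N.
  by move=> sX; rewrite -(cardsID X W) (setIidPr sX).
apply: etrans (etrans h _).
  congr (_ + _); apply: eq_bigr => X sX.
  by rewrite [in RHS](cX X) // -addSn addnK.
by apply: eq_bigr => X sX; rewrite [in LHS](cX X) // subSS -addSn !addnK.
Qed.

End Blocks.

(** * Sums over permutations *)

Local Notation porb := fingraph.orbit.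

(** * Cycles as sequences, and the removal of one element from a cycle *)

Section Orbits.
Variable T : finType.
Implicit Types (s : {perm T}) (x y a b : T).

Lemma mem_porb s x y : (y \in porb s x) = (y \in porbit s x).
Proof.
rewrite -fconnect_orbit; apply/idP/porbitP => [xy|[i ->]].
  by exists (findex s x y); rewrite permX iter_findex.
by rewrite permX fconnect_iter.
Qed.

Lemma card_porbit s x : #|porbit s x| = fingraph.order s x.
Proof.
rewrite -size_orbit -(card_uniqP (orbit_uniq s x)).
by apply: eq_card => y; rewrite mem_porb.
Qed.

Lemma porb_traject s x : porb s x = traject s x #|porbit s x|.
Proof. by rewrite card_porbit. Qed.

Lemma porb_fcycle s x p : fcycle s (x :: p) -> uniq (x :: p) ->
  porb s x = x :: p.
Proof.
by move=> cp up; rewrite (fingraph.orbitE cp up) ?mem_head // index_head rot0.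
Qed.

Lemma porb_cons s x : porb s x = x :: behead (porb s x).
Proof. by rewrite /fingraph.orbit -orderSpred. Qed.

Lemma porb_fix s x : s x = x -> porb s x = [:: x].
Proof. by move=> sx; apply: porb_fcycle => //=; rewrite sx eqxx. Qed.

(* [tperm a b * s] removes [b] from its cycle. *)
Section Bypass.
Variables (s : {perm T}) (a b : T).
Hypotheses (ab : a != b) (sab : s a = b).
Let s' := (tperm a b * s)%g.

Lemma bypass_a : s' a = s b. Proof. by rewrite permM tpermL. Qed.
Lemma bypass_b : s' b = b. Proof. by rewrite permM tpermR. Qed.
Lemma bypassD x : x != a -> x != b -> s' x = s x.
Proof. by move=> xa xb; rewrite permM tpermD // eq_sym. Qed.

Lemma bypass_notin : b \notin porb s' a.
Proof.
rewrite mem_porb porbit_sym -mem_porb porb_fix ?bypass_b // inE.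
exact: ab.
Qed.

Lemma bypass_porb : porb s a = a :: b :: behead (porb s' a).
Proof.
have cyc := cycle_orbit (@perm_inj _ s') a; have uni := orbit_uniq s' a.
have := bypass_notin; rewrite porb_cons in cyc uni *.
set t := behead _ in cyc uni *; rewrite inE negb_or => /andP[_ bt].
move: uni => /= /andP[at_ ut].
apply: porb_fcycle; last by rewrite /= inE negb_or ab at_ bt ut.
move: cyc; rewrite /= sab eqxx /=.
have hp p x y : x != a -> x != b -> a \notin p -> b \notin p ->
    fpath s' x (rcons p y) -> fpath s x (rcons p y).
  elim: p x => [|z p IH] x xa xb /=.
    by rewrite bypassD.
  rewrite !inE !negb_or => /andP[az ap] /andP[bz bp] /andP[sx hp].
  by rewrite -bypassD // sx IH // eq_sym.
case: t at_ bt {ut} => [|z t] /=; first by rewrite bypass_a.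
rewrite !inE !negb_or => /andP[az at_] /andP[bz bt] /andP[sa hz].
by rewrite -bypass_a sa hp // eq_sym.
Qed.

Lemma bypass_porb_other i : i \notin porb s a -> porb s' i = porb s i.
Proof.
move=> ia; have cyc := cycle_orbit (@perm_inj _ s) i.
have uni := orbit_uniq s i.
have anot : a \notin porb s i by rewrite mem_porb porbit_sym -mem_porb.
have bnot : b \notin porb s i.
  rewrite mem_porb porbit_sym; apply: contra ia => ib.
  rewrite mem_porb; move: ib; rewrite -sab -{2}[s]expg1 porbit_perm //.
rewrite (porb_cons s i) in cyc uni anot bnot *.
apply: porb_fcycle => //.
have -> : fcycle s' (i :: behead (porb s i)) = fcycle s (i :: behead (porb s i)); last by [].
apply: (@eq_in_cycle _ [predC [:: a; b]]).
  move=> x y; rewrite !inE !negb_or => /andP[xa xb] _ /=.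
  by rewrite bypassD.
apply/allP => x xp; rewrite !inE negb_or.
by apply/andP; split; [apply: contraNneq anot => <-|apply: contraNneq bnot => <-].
Qed.

End Bypass.
End Orbits.

Lemma sorted_enum_ord n : sorted (fun i j : 'I_n => (i < j)%N) (enum 'I_n).
Proof.
have := iota_ltn_sorted 0 n; rewrite -val_enum_ord.
by rewrite sorted_map.
Qed.

Lemma filter_enum_min n (P : pred 'I_n) (a : 'I_n) : P a ->
    (forall i, P i -> i != a -> (a < i)%N) ->
  [seq i <- enum 'I_n | P i] = a :: [seq i <- enum 'I_n | P i & i != a].
Proof.
move=> Pa hP.
have tr : transitive (fun i j : 'I_n => (i < j)%N) by move=> x y z; apply: ltn_trans.
apply: (irr_sorted_eq tr).
- by move=> x; rewrite /= ltnn.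
- by apply: sorted_filter => //; apply: sorted_enum_ord.
- rewrite /= path_sortedE // sorted_filter ?sorted_enum_ord // andbT.
  by apply/allP => x; rewrite mem_filter => /andP[/andP[Px xa] _]; apply: hP.
move=> x; rewrite in_cons mem_filter [in RHS]mem_filter !mem_enum /= !andbT.
by case: eqP => [->|]; rewrite ?Pa ?andbT.
Qed.

(** * Cycle words of permutations supported on a subset *)

Section CycleWords.
Variable n : nat.
Implicit Types (s : 'S_n) (X Y : {set 'I_n}) (a b i j : 'I_n).

(** Only the least elements of the cycles are required to lie in Y. For a permutation of a |: Y with
    a below Y, this drops exactly the cycle of a, which is treated separately while it is being
    read. *)
Definition cycles Y s : seq (seq 'I_n) :=
  [seq porb s i | i <- enum 'I_n & (i \in Y) && all (fun j => i <= j)%N (porb s i)].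

Lemma perm_on_porb Y s i : perm_on Y s -> i \in Y -> {subset porb s i <= Y}.
Proof.
move=> sY iY j; rewrite mem_porb => /porbitP[k ->].
elim: k => [|k IH]; first by rewrite expg0 perm1.
by rewrite expgSr permM perm_closed.
Qed.

Lemma cycles0 s : cycles set0 s = [::].
Proof.
rewrite /cycles (eq_filter (a2 := pred0)) ?filter_pred0 //.
by move=> i; rewrite inE.
Qed.

Lemma cyclesU1 a Y s : (forall x, x \in Y -> (a < x)%N) -> perm_on (a |: Y) s ->
  cycles (a |: Y) s = porb s a :: cycles Y s.
Proof.
move=> ha sY; rewrite /cycles (@filter_enum_min _ _ a) /=.
- congr (_ :: map _ _); apply: eq_filter => i /=; rewrite in_setU1.
  by have [->|ia] := eqVneq i a; rewrite /= ?andbF ?andbT // (negbTE (gt_notin ha)).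
- rewrite setU11; apply/allP => j /(perm_on_porb sY (setU11 _ _)).
  by rewrite in_setU1 => /predU1P[->|/ha/ltnW].
by move=> i /andP[]; rewrite in_setU1 => /predU1P[->|/ha //]; rewrite eqxx.
Qed.

(** The cycle of a has its least element outside Y, so it is listed on neither side; the new fixed
    point b is excluded from Y, and the other cycles contain neither a nor b. *)
Lemma cycles_bypass a b Y s : (forall x, x \in Y -> (a < x)%N) ->
    perm_on (a |: Y) s -> s a = b -> b \in Y ->
  cycles (Y :\ b) (tperm a b * s)%g = cycles Y s.
Proof.
move=> ha sY sab bY.
have ab : a != b by have := ha b bY; apply: contraTneq => ->; rewrite ltnn.
rewrite /cycles; set P := fun i => (i \in Y :\ b) && _; set P' := fun i => (i \in Y) && _.
have hP i : P' i -> i \notin porb s a.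
  move=> /andP[iY /allP hi]; rewrite mem_porb porbit_sym -mem_porb.
  by apply/negP => /hi; rewrite leqNgt ha.
have PP' : P =1 P'.
  move=> i; apply/idP/idP => [|Pi]; last first.
    have ia := hP _ Pi; case/andP: Pi => iY hi.
    rewrite /P bypass_porb_other // hi !inE iY !andbT.
    apply: contraNneq ia => ->; rewrite mem_porb -sab -{1}[s]expg1.
    exact: mem_porbit.
  rewrite /P !inE => /andP[/andP[ib iY] hi]; rewrite /P' iY /=.
  suff ia : i \notin porb s a by rewrite -(bypass_porb_other sab ia).
  apply/negP; rewrite (bypass_porb ab sab) !inE (negbTE ib) /= => /orP[/eqP ia|ia].
    by have := ha i iY; rewrite ia ltnn.
  have {}ia : i \in porb (tperm a b * s)%g a by rewrite porb_cons inE ia orbT.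
  have /(allP hi) : a \in porb (tperm a b * s)%g i.
    by rewrite mem_porb porbit_sym -mem_porb.
  by rewrite leqNgt ha.
rewrite (eq_filter PP'); apply/eq_in_map => i; rewrite mem_filter => /andP[/hP ia _].
exact: bypass_porb_other.
Qed.

Lemma perm_on_bypass a b Y s : a != b -> b \in Y -> a \notin Y -> s a = b ->
  perm_on (a |: Y) s = perm_on (a |: (Y :\ b)) (tperm a b * s)%g.
Proof.
move=> ab bY aY sab.
apply/subsetP/subsetP => h x; rewrite !inE => hx.
  have [->//|xa] := eqVneq x a.
  have [xb|xb] := eqVneq x b; first by rewrite xb bypass_b ?eqxx in hx.
  rewrite bypassD // in hx.
  by have := h x; rewrite !inE (negbTE xa) => ->.
have [->//|xa] := eqVneq x a; have [->//|xb] := eqVneq x b.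
by have := h x; rewrite !inE bypassD // (negbTE xa) (negbTE xb) => ->.
Qed.

Lemma flatten_cycles_perm Y s : perm_on Y s ->
  perm_eq (flatten (cycles Y s)) (enum Y).
Proof.
have enumU1 (x : 'I_n) (Z : {set 'I_n}) : x \notin Z -> perm_eq (enum (x |: Z)) (x :: enum Z).
  move=> xZ; apply: uniq_perm; rewrite ?enum_uniq //= ?mem_enum ?xZ ?enum_uniq //.
  by move=> y; rewrite !inE !mem_enum !inE.
have [k] := ubnP #|Y|; elim: k => // k IHk in Y s *; rewrite ltnS => hk sY.
have [->|[a [Z [ha eY]]]] := set_min_case Y; first by rewrite cycles0 /= enum_set0.
have aZ := gt_notin ha; rewrite eY in hk sY *.
rewrite cyclesU1 // perm_sym (perm_trans (enumU1 _ _ aZ)) // perm_sym.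
rewrite cardsU1 aZ add1n in hk.
have [sa|sa] := eqVneq (s a) a.
  rewrite porb_fix //= perm_cons IHk //.
  apply/subsetP => x; rewrite inE => sx.
  have := subsetP sY x; rewrite !inE sx => /(_ isT)/predU1P[xa|//].
  by rewrite xa sa eqxx in sx.
have bZ : s a \in Z.
  by have := perm_closed a sY; rewrite !inE eqxx (negbTE sa).
have ab : a != s a by rewrite eq_sym.
have sY' := sY; rewrite (perm_on_bypass ab bZ aZ) // in sY'.
have hb : (#|a |: (Z :\ s a)| < k)%N.
  by rewrite cardsU1 !inE (negbTE aZ) andbF add1n; rewrite (cardsD1 (s a)) bZ in hk.
have haD x : x \in Z :\ s a -> (a < x)%N by rewrite inE => /andP[_ /ha].
have := IHk _ _ hb sY'; rewrite cyclesU1 // (cycles_bypass ha sY) //.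
rewrite (bypass_porb ab erefl) (porb_cons (_ * _)%g) /=.
have aD : a \notin Z :\ s a by rewrite !inE (negbTE aZ) andbF.
move=> /perm_trans - /(_ _ (enumU1 _ _ aD)); rewrite !perm_cons => h.
have {2}-> : Z = s a |: (Z :\ s a) by rewrite setD1K.
by rewrite perm_sym (perm_trans (enumU1 _ _ _)) ?inE ?eqxx // perm_cons perm_sym.
Qed.

End CycleWords.

Lemma open_cycle_perm n (Y : {set 'I_n}) (a : 'I_n) (s : 'S_n) :
    (forall x, x \in Y -> (a < x)%N) -> perm_on (a |: Y) s ->
  perm_eq (behead (porb s a) ++ flatten (cycles Y s)) (enum Y).
Proof.
move=> ha sY; have aY := gt_notin ha.
have := flatten_cycles_perm sY; rewrite cyclesU1 //= {1}porb_cons /= => h.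
rewrite -(perm_cons a); apply: perm_trans h _.
apply: uniq_perm; rewrite ?enum_uniq //= ?mem_enum ?aY ?enum_uniq //.
by move=> y; rewrite !inE !mem_enum !inE.
Qed.

(** The factors f are replaced by g in increasing order of x, and each summand is the change caused
    by the replacement at b. *)
Lemma telescope_prod n (R : comNzRingType) (X : {set 'I_n}) (t : nat) (f g : 'I_n -> R) :
  \prod_(x in X) (if (x <= t)%N then g x else f x) =
  \prod_(x in X) f x + \sum_(b in X | (b <= t)%N)
    (g b - f b) * \prod_(x in X :\ b) (if (x < b)%N then g x else f x).
Proof.
elim/set_max_ind: X => [|z X hz IH].
  by rewrite !big_set0 big_pred0 ?addr0 // => i; rewrite inE.
have zX := lt_notin hz; rewrite !big_setU1 //= IH.
rewrite (big_mkcondr _ _ (in_mem^~ (mem (z |: X)))) /= big_setU1 //= -big_mkcondr /=.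
have -> : (z |: X) :\ z = X by rewrite setU1K.
have -> : \prod_(x in X) (if (x < z)%N then g x else f x) = \prod_(x in X) g x.
  by apply: eq_bigr => x /hz ->.
have -> : \sum_(b in X | (b <= t)%N) (g b - f b) *
     \prod_(x in (z |: X) :\ b) (if (x < b)%N then g x else f x) =
   f z * \sum_(b in X | (b <= t)%N) (g b - f b) *
     \prod_(x in X :\ b) (if (x < b)%N then g x else f x).
  rewrite mulr_sumr; apply: eq_bigr => b /andP[bX _].
  have zb : z != b by apply: contraNneq zX => ->.
  rewrite setU1D_notin ?inE // big_setU1 ?inE ?(negbTE zX) ?andbF //=.
  by rewrite ltnNge ltnW ?hz //=; ring.
set S := \sum_(b in X | _) _; case: leqP => zt; last by ring.
suff -> : \prod_(x in X) g x = \prod_(x in X) f x + S by ring.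
by rewrite -IH; apply: eq_bigr => x /hz xz; rewrite (leq_trans (ltnW xz) zt).
Qed.

(** * Reading the cycle of the least vertex element by element *)

Section PermSums.
Variables (n : nat) (m : 'I_n -> 'I_n) (R : comNzRingType) (q : R) (E : nat -> R).
Hypotheses (m_mono : forall i j : 'I_n, (i <= j)%N -> (m i <= m j)%N)
  (m_ge : forall i : 'I_n, (i <= m i)%N).
Implicit Types (s : 'S_n) (X Y : {set 'I_n}) (a b i j : 'I_n).

Definition asc_edge : rel 'I_n := fun i j => (i < j <= m i)%N.
Local Notation e := asc_edge.

Lemma asc_edge_interval : interval_rel e [set: 'I_n].
Proof.
move=> i j _ _ /andP[ij jm]; split=> // k _ /andP[ik kj].
rewrite /e ik kj (leq_trans (ltnW kj) jm) (leq_trans jm) //.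
by apply: m_mono; apply: ltnW.
Qed.

Fixpoint word_inv (w : seq 'I_n) : nat :=
  if w is x :: w' then (count (fun y => e y x) w' + word_inv w')%N else 0%N.

Definition cycles_wt (cs : seq (seq 'I_n)) : R :=
  \prod_(c <- cs) ((q - 1) ^+ (size c).-1 * E (size c)).

Definition perm_wt Y s : R :=
  q ^+ word_inv (flatten (cycles Y s)) * cycles_wt (cycles Y s).

Definition bounded Y s : bool := [forall i in Y, (s i <= m i)%N].

Definition perm_sum Y : R :=
  \sum_(s : 'S_n | perm_on Y s && bounded Y s) perm_wt Y s.

(** The factors q - 1 are charged for the elements still to be read, whereas E takes the full length
    of the cycle. *)
Definition open_wt Y a r s : R :=
  let w := behead (porb s a) in
  q ^+ word_inv (w ++ flatten (cycles Y s)) *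
    ((q - 1) ^+ size w * E (r + size w)%N) * cycles_wt (cycles Y s).

(* The cycle of [a] is being read and [r] of its elements are known; [t] bounds
   the image of the last one, in the place of which [a] stands. *)
Definition open_sum Y a (t r : nat) : R :=
  \sum_(s : 'S_n | [&& perm_on (a |: Y) s, bounded Y s &
                       (s a == a) || (s a <= t)%N]) open_wt Y a r s.

Lemma open_wt_bypass Y a b r s : (forall x, x \in Y -> (a < x)%N) ->
    perm_on (a |: Y) s -> s a = b -> b \in Y ->
  open_wt Y a r s = (q - 1) * (q ^+ cross e Y [set b] *
    open_wt (Y :\ b) a r.+1 (tperm a b * s)%g).
Proof.
move=> ha sY sab bY.
have ab : a != b by have := ha b bY; apply: contraTneq => ->; rewrite ltnn.
have aY := gt_notin ha.
have haD x : x \in Y :\ b -> (a < x)%N by rewrite inE => /andP[_ /ha].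
have sY' := sY; rewrite (perm_on_bypass ab bY aY sab) in sY'.
have := open_cycle_perm haD sY'.
rewrite /open_wt (cycles_bypass ha sY sab bY) (bypass_porb ab sab) /=.
set w := behead _; set F := flatten _ => hp.
rewrite (seq.permP hp) exprD -addSnnS exprS.
suff -> : count (fun y => e y b) (enum (Y :\ b)) = cross e Y [set b] by ring.
rewrite -(setD1K bY) crossU1l ?inE ?eqxx // cross1l big_set1 /e ltnn add0n.
rewrite cross1r -sum1_count big_enum_cond /= big_mkcondr /=.
rewrite setU1K ?inE ?eqxx //.
Qed.

(** Either the cycle closes, with s a = a, or its next element is b = s a. In the word b precedes
    all of Y - b, whence the exponent; bypassing b then leaves an open cycle whose next element is
    bounded by m b. *)
Lemma open_sumE Y a t r : (forall x, x \in Y -> (a < x)%N) ->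
  open_sum Y a t r = E r * perm_sum Y +
    (q - 1) * \sum_(b in Y | (b <= t)%N)
       q ^+ cross e Y [set b] * open_sum (Y :\ b) a (m b) r.+1.
Proof.
move=> ha; have aY := gt_notin ha.
rewrite /open_sum (bigID (fun s : 'S_n => s a == a)) /=; congr (_ + _).
  rewrite /perm_sum mulr_sumr; apply: eq_big => s.
    apply/andP/andP => [[/and3P[sY bs _] /eqP sa]|[sY bs]].
      split=> //; apply/subsetP => x; rewrite inE => sx.
      have := subsetP sY x; rewrite !inE sx => /(_ isT)/predU1P[xa|//].
      by rewrite xa sa eqxx in sx.
    rewrite (out_perm sY aY) eqxx bs /=; split=> //.
    by rewrite andbT; apply: subset_trans sY (subsetUr _ _).
  move=> /andP[_ /eqP sa]; rewrite /open_wt /perm_wt porb_fix //= addn0 expr0.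
  by ring.
rewrite (partition_big (fun s : 'S_n => s a) (fun b => (b \in Y) && (b <= t)%N)) /=; last first.
  move=> s /andP[/and3P[sY _ sat] sa]; rewrite (negbTE sa) /= in sat.
  by have := perm_closed a sY; rewrite !inE eqxx (negbTE sa) sat andbT.
rewrite mulr_sumr; apply: eq_bigr => b /andP[bY bt].
have ab : a != b by have := ha b bY; apply: contraTneq => ->; rewrite ltnn.
(* From here on [s] is the permutation with b bypassed, and the original one is [tperm a b * s]. *)
rewrite !mulr_sumr (reindex_inj (mulgI (tperm a b))) /=.
apply: eq_big => s; last first.
  move=> /andP[/andP[/and3P[sY _ _] _] /eqP sab].
  by rewrite (open_wt_bypass _ ha sY sab bY) mulgA tperm2 mul1g.
set s1 := (tperm a b * s)%g.
have e1 : (tperm a b * s1)%g = s by rewrite /s1 mulgA tperm2 mul1g.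
have s1a : s1 a = s b by rewrite permM tpermL.
have s1b : s1 b = s a by rewrite permM tpermR.
have [sb|sb] := eqVneq (s b) b; last first.
  rewrite s1a (negbTE sb) andbF; symmetry; apply/negbTE/negP => /and3P[sY _ _].
  by rewrite (out_perm sY) ?eqxx // ?inE ?eqxx ?orbF in sb; rewrite eq_sym.
rewrite s1a sb eqxx andbT (eq_sym b a) ab bt orbT !andbT.
rewrite (perm_on_bypass ab bY aY) ?s1a // e1; congr (_ && _).
apply/forall_inP/andP => [hs|[/forall_inP hs sa] i iY].
  split.
    apply/forall_inP => i; rewrite !inE => /andP[ib iY].
    have ia : i != a by apply: contraNneq aY => <-.
    by have := hs i iY; rewrite permM tpermD // eq_sym.
  by rewrite -s1b (hs b bY) orbT.
have ia : i != a by apply: contraNneq aY => <-.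
have [ib|ib] := eqVneq i b.
  (* If the cycle closes after b, the bound at b holds because a < b <= m b. *)
  rewrite ib s1b; case/predU1P: sa => [->|//].
  by apply: leq_trans (m_ge b); apply/ltnW/ha.
have := hs i; rewrite !inE ib iY permM tpermD 1?eq_sym //; exact.
Qed.

(** By [open_block_wtE] this is (q - 1)^#|X| times the sum of q^inv over the admissible orders of
    reading X, when t bounds the first element and m b bounds the successor of b. *)
Definition open_block_wt (t : nat) X : R :=
  \prod_(x in X) (q ^+ (cross e X [set x] + (x <= t)%N) - 1).

Lemma open_block_wt0 t : open_block_wt t set0 = 1.
Proof. by rewrite /open_block_wt big_set0. Qed.

(** Raising the exponents of the elements up to t one by one telescopes, and each change is (q - 1)
    q^(cross X b) times a product that is again an open block weight, for X - b and the bound m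
    b. *)
Lemma open_block_wtE t X : X != set0 ->
  open_block_wt t X = (q - 1) * \sum_(b in X | (b <= t)%N)
    q ^+ cross e X [set b] * open_block_wt (m b) (X :\ b).
Proof.
move=> X0; pose f x := q ^+ cross e X [set x] - 1.
pose g x := q ^+ (cross e X [set x]).+1 - 1.
transitivity (\prod_(x in X) (if (x <= t)%N then g x else f x)).
  by apply: eq_bigr => x _; case: ifP => _; rewrite ?addn1 ?addn0.
rewrite telescope_prod.
(* No ascending edge enters the least element, so its factor is 1 - 1. *)
have -> : \prod_(x in X) f x = 0.
  have [X0'|[a [Z [ha eX]]]] := set_min_case X; first by rewrite X0' eqxx in X0.
  rewrite (bigD1 a) ?eX ?setU11 //= -{1}eX /f.
  rewrite (cross_above asc_edge_interval) ?expr0 ?subrr ?mul0r // => x y.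
  by rewrite eX !inE => /predU1P[->|/ha/ltnW xa] /eqP->.
rewrite add0r mulr_sumr; apply: eq_bigr => b /andP[bX _].
rewrite mulrA; congr (_ * _); first by rewrite /f /g exprS; ring.
apply: eq_bigr => x; rewrite !inE /f /g => /andP[xb xX].
have -> : cross e X [set x] = (e b x + cross e (X :\ b) [set x])%N.
  by rewrite -{1}(setD1K bX) crossU1l ?inE ?eqxx // [in LHS]cross1l big_set1.
(* For x < b the bound x <= m b holds and yields the raised exponent; for x > b this bound is the
   edge from b to x, lost when b leaves X. *)
rewrite [e b x]/e; case: ltngtP xb => [xltb|bltx|/val_inj->]; rewrite ?eqxx // => _.
  by rewrite add0n (leq_trans (ltnW xltb) (m_ge b)) addn1.
by rewrite addnC.
Qed.

(** For x above a, the bound x <= m a is the edge from a to x. *)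
Lemma open_block_wt_closed a X : (forall x, x \in X -> (a < x)%N) ->
  open_block_wt (m a) X = block_wt q e (a |: X).
Proof.
move=> ha; have aX := gt_notin ha.
rewrite /block_wt (_ : _ != _) ?mul1r; last by apply/set0Pn; exists a; rewrite setU11.
apply: eq_big => [x|x xX].
  rewrite in_setU1; have [->|xa] := eqVneq x a.
    rewrite (negbTE aX); symmetry; apply/negbTE/exists_inP => -[y].
    by rewrite in_setU1 => /predU1P[->|/ha/ltnW]; rewrite ?ltnn // leqNgt => /negbTE->.
  case xX: (x \in X) => //=; symmetry; apply/exists_inP.
  by exists a; rewrite ?setU11 // ha.
rewrite crossU1l // [cross e [set a] _]cross1l big_set1 /e ha //= addnC.
by [].
Qed.

(** Iterating [open_sumE] collects the unread part X of the open cycle; the remaining cycles form a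
    permutation of Y - X. *)
Lemma open_sum_blocks Y a t r : (forall x, x \in Y -> (a < x)%N) ->
  open_sum Y a t r = \sum_(X : {set 'I_n} | X \subset Y)
    q ^+ cross e (Y :\: X) X * open_block_wt t X * E (r + #|X|)%N *
      perm_sum (Y :\: X).
Proof.
have [k] := ubnP #|Y|; elim: k => // k IHk in Y t r *; rewrite ltnS => hk ha.
rewrite open_sumE //.
have haD b x : x \in Y :\ b -> (a < x)%N by rewrite inE => /andP[_ /ha].
under eq_bigr => b /andP[bY _].
  rewrite IHk; last 2 first.
  - by apply: leq_trans hk; rewrite [X in (_ < X)%N](cardsD1 b) bY.
  - exact: haD.
  rewrite mulr_sumr; over.
rewrite (bigD1 set0) ?sub0set //= setD0 cross0r open_block_wt0 cards0 addn0 expr0 !mul1r.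
congr (_ + _).
transitivity (\sum_(X : {set 'I_n} | (X \subset Y) && (X != set0))
    \sum_(b in X | (b <= t)%N) q ^+ cross e (Y :\: X) X *
      ((q - 1) * (q ^+ cross e X [set b] * open_block_wt (m b) (X :\ b))) *
      E (r + #|X|)%N * perm_sum (Y :\: X)); last first.
  apply: eq_bigr => X /andP[_ X0]; rewrite open_block_wtE //.
  by move: (perm_sum _) => c; rewrite !mulr_sumr !mulr_suml.
rewrite [RHS](exchange_big_dep (fun b => (b \in Y) && (b <= t)%N)) /=; last first.
  by move=> X b /andP[/subsetP sX _] /andP[/sX-> ->].
rewrite mulr_sumr; apply: eq_bigr => b /andP[bY bt]; rewrite mulr_sumr.
rewrite [RHS](reindex_onto (fun X => b |: X) (fun X => X :\ b)) /=; last first.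
  by move=> X /andP[_ /andP[bX _]]; rewrite setD1K.
apply: eq_big => X.
  rewrite bt setU11 !andbT subsetD1 subUset sub1set bY /=.
  have -> : b |: X != set0 by apply/set0Pn; exists b; rewrite setU11.
  rewrite andbT; congr (_ && _).
  apply/idP/eqP => [bX|<-]; first by rewrite setU1K.
  by rewrite !inE eqxx.
rewrite subsetD1 => /andP[sX bX].
have eD : Y :\: (b |: X) = Y :\ b :\: X by rewrite setDDl.
have bD : b \notin Y :\: (b |: X) by rewrite !inE eqxx.
have ebb : cross e [set b] [set b] = 0%N by rewrite cross1l big_set1 /e ltnn.
have cY : cross e Y [set b] =
    (cross e X [set b] + cross e (Y :\: (b |: X)) [set b])%N.
  have sbX : b |: X \subset Y by rewrite subUset sub1set bY.
  rewrite -{1}(setID Y (b |: X)) (setIidPr sbX) crossUl ?setD_disjoint //.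
  by rewrite crossU1l // ebb.
rewrite setU1K // cardsU1 bX add1n addnS -addSn crossU1r // [cross e (b |: X) _]crossU1l // ebb.
by rewrite cY -eD !exprD; ring.
Qed.

Lemma perm_sum_block_rec : block_rec q e E perm_sum.
Proof.
split.
  rewrite /perm_sum (big_pred1 1%g) => [|s].
    by rewrite /perm_wt cycles0 /= /cycles_wt big_nil expr0 mulr1.
  apply/andP/eqP => [[s0 _]|->]; last first.
    by split; [apply/subsetP => x; rewrite inE perm1 eqxx | apply/forall_inP => i; rewrite inE].
  by apply/permP => x; rewrite perm1; apply: out_perm s0 _; rewrite inE.
move=> a Y ha; have aY := gt_notin ha.
transitivity (open_sum Y a (m a) 1).
  apply: eq_big => s; last first.
    move=> /andP[sY _]; rewrite /perm_wt /open_wt cyclesU1 //=.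
    rewrite /cycles_wt big_cons -/(cycles_wt _) {1 2 3}porb_cons /= add1n.
    set w := behead _; set F := flatten _.
    suff -> : count (fun y => e y a) (w ++ F) = 0%N by rewrite add0n; ring.
    rewrite (seq.permP (open_cycle_perm ha sY)); apply/eqP; rewrite -leqn0 leqNgt -has_count.
    apply/hasPn => x; rewrite mem_enum => /ha ax; rewrite /e negb_and -leqNgt ltnW //.
  congr (_ && _); apply/forall_inP/andP => [h|[/forall_inP h sa] i].
    split; last by rewrite h ?setU11 ?orbT.
    by apply/forall_inP => i iY; rewrite h // setU1r.
  by rewrite in_setU1 => /predU1P[->|/h //]; case/predU1P: sa => [->|].
rewrite open_sum_blocks //; apply: eq_bigr => X sX.
by rewrite open_block_wt_closed // => x /(subsetP sX)/ha.
Qed.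

End PermSums.

(** * Identification with the weight and the cycle type of the statement *)

Section Link.
Variables (n : nat) (m : 'I_n -> 'I_n).
Implicit Types (s : 'S_n).
Local Notation e := (asc_edge m).

Lemma inversionsE (w : seq 'I_n) : inversions (indiff_graph m) w = word_inv m w.
Proof.
rewrite /inversions cardsE -sum1_card big_mkcond /=.
rewrite (eq_bigr (fun p : 'I_(size w) * 'I_(size w) =>
  ((p.1 < p.2)%N && e (tnth (in_tuple w) p.2) (tnth (in_tuple w) p.1) : nat))); last first.
  move=> [i j] _; rewrite unfold_in /= /indiff_graph /e.
  by case: (i < j)%N; case: ltngtP => //= _; case: (_ <= _)%N.
rewrite -(pair_bigA _ (fun i j : 'I_(size w) =>
  ((i < j)%N && e (tnth (in_tuple w) j) (tnth (in_tuple w) i) : nat))) /=.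
elim: w => [|x w IH]; first by rewrite big_ord0.
rewrite big_ord_recl /= big_ord_recl /= add0n; congr (_ + _)%N.
  rewrite -sum1_count (big_tnth _ _ w) [RHS]big_mkcond /=.
  by apply: eq_bigr => i _; rewrite !(tnth_nth x) /=; case: (e _ _).
rewrite -IH; apply: eq_bigr => i _; rewrite big_ord_recl /= add0n.
by apply: eq_bigr => j _; rewrite !(tnth_nth x) /= /bump /= !add1n ltnS.
Qed.

Lemma cycle_wordE s : cycle_word s = flatten (cycles [set: 'I_n] s).
Proof.
rewrite /cycle_word /cycles; congr flatten.
rewrite (eq_map (porb_traject s)).
congr map; apply: eq_filter => i; rewrite in_setT /=.
apply/forall_inP/allP => h j; have := h j; rewrite ?mem_porb //.
Qed.

Lemma wtE s : wt (indiff_graph m) s = word_inv m (flatten (cycles [set: 'I_n] s)).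
Proof. by rewrite /wt inversionsE cycle_wordE. Qed.

(** Each orbit has exactly one least element, so orbits correspond to the listed cycles. *)
Lemma cycle_type_perm s :
  perm_eq (cycle_type s) [seq size c | c <- cycles [set: 'I_n] s].
Proof.
rewrite /cycle_type perm_sort perm_sym /cycles -map_comp.
set st := filter _ _.
rewrite (eq_map (_ : size \o porb s =1 (fun C : {set 'I_n} => #|C|) \o porbit s)); last first.
  by move=> i /=; rewrite size_orbit card_porbit.
rewrite map_comp; apply: perm_map; apply: uniq_perm; rewrite ?enum_uniq //.
  rewrite map_inj_in_uniq => [|i j]; first exact/filter_uniq/enum_uniq.
  rewrite mem_filter => /andP[/andP[_ /allP hi] _].
  rewrite mem_filter => /andP[/andP[_ /allP hj] _] eij.
  have ij : (i <= j)%N by apply: hi; rewrite mem_porb eij porbit_id.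
  have ji : (j <= i)%N by apply: hj; rewrite mem_porb -eij porbit_id.
  by apply/val_inj/anti_leq; rewrite ij ji.
move=> C; rewrite mem_enum; apply/mapP/imsetP => -[i _ ->]; first by exists i.
have [j ji jmin] := arg_minnP (fun j : 'I_n => j : nat) (porbit_id s i).
have {}ji : j \in porbit s i := ji.
exists j; last by apply/eqP; rewrite eq_porbit_mem porbit_sym.
rewrite mem_filter in_setT mem_enum andbT; apply/allP => k.
rewrite mem_porb => kj; apply: jmin.
by have /eqP <- : porbit s j == porbit s i by rewrite eq_porbit_mem.
Qed.

Lemma sumn_cycle_type s : sumn (cycle_type s) = n.
Proof.
rewrite (perm_sumn (cycle_type_perm s)) -size_flatten /=.
have hs : perm_on [set: 'I_n] s by apply/subsetP => i _; rewrite in_setT.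
by rewrite (perm_size (flatten_cycles_perm hs)) -cardE cardsT card_ord.
Qed.

Lemma cycle_type_gt0 s : all (leq 1) (cycle_type s).
Proof.
rewrite (perm_all _ (cycle_type_perm s)); apply/allP => k /mapP[c /mapP[i _ ->] ->].
by rewrite size_orbit fingraph.order_gt0.
Qed.

Lemma cycle_type_partition s : is_partition n (cycle_type s).
Proof.
rewrite /is_partition sumn_cycle_type eqxx andbT sort_sorted /=; last first.
  by move=> i j; apply: leq_total.
by apply/negP => /(allP (cycle_type_gt0 s)).
Qed.

Lemma perm_wtE (R : comNzRingType) (q : R) (E : nat -> R) s :
  perm_wt m q E [set: 'I_n] s =
  (q - 1) ^+ (n - size (cycle_type s)) * q ^+ wt (indiff_graph m) s *
    \prod_(k <- cycle_type s) E k.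
Proof.
rewrite /perm_wt /cycles_wt wtE [X in _ = X * _]mulrC -mulrA; congr (_ * _).
rewrite -(big_map size predT (fun k => (q - 1) ^+ k.-1 * E k)).
rewrite -(perm_big _ (cycle_type_perm s)) big_split /=.
rewrite -[X in (X - _)%N](sumn_cycle_type s); congr (_ * _).
elim: (cycle_type s) (cycle_type_gt0 s) => [|k l IH] /= => [_|/andP[k0 /[dup] l0 /IH h]].
  by rewrite big_nil.
rewrite big_cons h -exprD; congr (_ ^+ _).
(* All parts are positive, so the truncated subtractions are exact. *)
have : (size l <= sumn l)%N.
  elim: l l0 {h IH} => //= x l IH /andP[x0 /IH].
  lia.
lia.
Qed.

End Link.

(** * Colorings *)

Section Colorings.
Variables (n : nat) (m : 'I_n -> 'I_n) (R : comNzRingType) (q : R) (x : nat -> R).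
Hypotheses (m_mono : forall i j : 'I_n, (i <= j)%N -> (m i <= m j)%N)
  (m_ge : forall i : 'I_n, (i <= m i)%N).
Implicit Types (C X Y : {set 'I_n}).
Local Notation e := (asc_edge m).

Fixpoint elem_sym N k : R :=
  match k, N with
  | 0, _ => 1
  | k'.+1, 0 => 0
  | k'.+1, N'.+1 => elem_sym N' k + x N' * elem_sym N' k'
  end.

Definition color_asc N Y (kappa : 'I_n -> 'I_N.+1) : nat :=
  (\sum_(i in Y) \sum_(j in Y) (e i j && (kappa i < kappa j)%N))%N.

(* Partial colorings with domain [Y]: [0] means uncolored, and [c.+1] the color [c]. *)
Definition color_sum N Y : R :=
  \sum_(kappa : {ffun 'I_n -> 'I_N.+1} | [forall i, (kappa i != ord0) == (i \in Y)])
    q ^+ color_asc Y kappa * \prod_(i in Y) x (kappa i).-1.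

Lemma color_sum0 Y : color_sum 0 Y = (Y == set0)%:R.
Proof.
rewrite /color_sum; have [->|/set0Pn[i iY]] := eqVneq Y set0; last first.
  rewrite big_pred0 // => kappa; apply/negbTE/forallPn; exists i.
  by rewrite iY ord1.
rewrite (big_pred1 [ffun=> ord0]) => [|kappa].
  by rewrite /color_asc !big_set0 expr0 mulr1.
apply/forallP/eqP => [_|_ i]; last by rewrite inE ord1.
by apply/ffunP => i; rewrite ffunE ord1.
Qed.

(** C is the set of vertices with the largest color; removing it leaves a coloring with N colors. *)
Lemma color_sumS N Y : color_sum N.+1 Y = \sum_(C : {set 'I_n} | C \subset Y)
  x N ^+ #|C| * q ^+ cross e (Y :\: C) C * color_sum N (Y :\: C).
Proof.
rewrite {1}/color_sum (partition_big (fun kappa : {ffun 'I_n -> 'I_N.+2} =>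
  [set i | kappa i == ord_max]) (fun C : {set 'I_n} => C \subset Y)) /=; last first.
  move=> kappa /forallP hk; apply/subsetP => i; rewrite inE => /eqP ki.
  by have /eqP <- := hk i; rewrite ki.
apply: eq_bigr => C sC; rewrite mulr_sumr.
pose h (k : {ffun 'I_n -> 'I_N.+1}) : {ffun 'I_n -> 'I_N.+2} :=
  [ffun i => if i \in C then ord_max else widen_ord (leqnSn N.+1) (k i)].
pose h' (k : {ffun 'I_n -> 'I_N.+2}) : {ffun 'I_n -> 'I_N.+1} :=
  [ffun i => if k i == ord_max then ord0 else inord (k i)].
have widen_neq (c : 'I_N.+1) : (widen_ord (leqnSn N.+1) c == ord_max) = false.
  by apply/negbTE; rewrite -val_eqE /= neq_ltn ltn_ord.
rewrite (reindex_onto h h') /=; last first.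
  move=> k /andP[_ /eqP kC]; apply/ffunP => i; rewrite !ffunE -kC inE.
  case: eqP => [->//|/eqP ki]; apply/val_inj; rewrite /= inordK //.
  by have := ltn_ord (k i); rewrite ltnS leq_eqVlt -val_eqE /= in ki *; rewrite (negbTE ki).
have hC k : [set i | h k i == ord_max] = C.
  by apply/setP => i; rewrite inE ffunE; case: ifP => //; rewrite ?eqxx ?widen_neq.
apply: eq_big => k.
  rewrite hC eqxx andbT; apply/andP/forallP => [[/forallP hk /eqP hk'] i|hk].
    have := congr1 (fun f : {ffun 'I_n -> 'I_N.+1} => f i) hk'; rewrite !ffunE inE.
    have := hk i; rewrite ffunE; case: ifP => iC //= _.
    by rewrite eqxx => <-.
  split; last first.
    apply/eqP/ffunP => i; rewrite !ffunE; have := hk i; rewrite inE.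
    case: (i \in C) => /=; rewrite ?eqxx ?widen_neq /=; last first.
      by move=> _; apply/val_inj; rewrite /= inordK.
    by rewrite eqbF_neg negbK => /eqP.
  apply/forallP => i; have := hk i; rewrite !ffunE inE; case: ifP => iC //=.
  by rewrite (subsetP sC).
move=> _.
(* Every edge from outside C into C is an ascent, and no edge that starts in C is. *)
have -> : color_asc Y (h k) = (cross e (Y :\: C) C + color_asc (Y :\: C) k)%N.
  rewrite /color_asc (big_setID C) /= (setIidPr sC) big1 ?add0n => [|i iC]; last first.
    rewrite big1 // => j _; rewrite ffunE iC ltnNge -ltnS ltn_ord andbF //.
  rewrite /cross -big_split /=; apply: eq_bigr => i; rewrite inE => /andP[iC iY].
  rewrite (big_setID C) /= (setIidPr sC); congr (_ + _)%N.
    apply: eq_bigr => j jC; rewrite !ffunE jC (negbTE iC) /= ltn_ord andbT //.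
  by apply: eq_bigr => j; rewrite inE => /andP[jC jY]; rewrite !ffunE (negbTE jC) (negbTE iC).
have -> : \prod_(i in Y) x (h k i).-1 = x N ^+ #|C| * \prod_(i in Y :\: C) x (k i).-1.
  rewrite (big_setID C) /= (setIidPr sC); congr (_ * _).
    by rewrite -prodr_const; apply: eq_bigr => i iC; rewrite ffunE iC.
  by apply: eq_bigr => i; rewrite inE => /andP[iC _]; rewrite ffunE (negbTE iC).
by rewrite exprD; ring.
Qed.

Lemma perm_sum_elem_sym N Y : perm_sum m q (elem_sym N) Y = color_sum N Y.
Proof.
elim: N Y => [|N IH] Y.
  rewrite color_sum0; have [S0 SU] := perm_sum_block_rec q (elem_sym 0) m_mono m_ge.
  have [->|[a [Z [ha ->]]]] := set_min_case Y; first by rewrite S0 eqxx.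
  rewrite SU // big1 => [|X _]; last by rewrite mulr0 mul0r.
  suff /negbTE-> : a |: Z != set0 by [].
  by apply/set0Pn; exists a; rewrite setU11.
rewrite color_sumS (@block_rec_add_var _ _ q e _ (elem_sym N) (elem_sym N.+1)
  (perm_sum m q (elem_sym N)) _ (x N)) //.
- by apply: eq_bigr => C _; rewrite IH.
- exact: asc_edge_interval.
- exact: perm_sum_block_rec.
- exact: perm_sum_block_rec.
by case: N {IH}.
Qed.

End Colorings.

(** * Formal power series *)

From mathcomp Require Import finmap multiset.
From mathcomp Require Import boolp classical_sets functions cardinality fsbigop.
From mathcomp.multinomials Require Import monalg.

Import GRing.Theory.
Local Open Scope classical_set_scope.
Local Open Scope ring_scope.

Lemma msetD_eq0 (a b : monom) : msetD a b = mset0 -> a = mset0 /\ b = mset0.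
Proof.
move=> ab; have h i : (a i + b i = 0)%N.
  by have := congr1 (fun c : multiset nat => c i) ab; rewrite msetE2 mset0E.
by split; apply/msetP => i; have := h i; rewrite mset0E; lia.
Qed.

HB.instance Definition _ := Choice.on monom.
HB.instance Definition _ := Choice_isMonomialDef.Build monom
  (@msetDA nat) (@mset0D nat) (@msetD0 nat) msetD_eq0.
HB.instance Definition _ := MonomialDef_isConomialDef.Build monom (@msetDC nat).

Local Notation mpolys := {malg {poly int}[monom]}.

Definition mvar (i : nat) : mpolys := << ([mset i]%mset : monom) >>.

Lemma mcoeff_monomM (u b : monom) (g : mpolys) :
  (<< u >> * g)@_(mmul u b) = g@_b.
Proof.
rewrite mcoeffMl msuppU1 big_seq_fset1 mcoeffUU.
have cancelu (k : monom) : (mmul u k == mmul u b) = (k == b).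
  apply/eqP/eqP => [h|->//]; apply/msetP => i.
  have := congr1 (fun c : multiset nat => c i) h.
  by rewrite !msetE2 => /addnI.
under eq_bigr => k _ do rewrite cancelu mul1r.
have [bg|bg] := boolP (b \in msupp g).
  rewrite (bigD1_seq b) ?fset_uniq //= eqxx mulr1n big1 ?addr0 // => k /negbTE->.
  by rewrite mulr0n.
rewrite mcoeff_outdom // big1_seq // => k /andP[_ kg].
by case: eqP kg => [->|]; rewrite ?(negbTE bg).
Qed.

Definition mdel (a : monom) (i : nat) : monom := msetB a [mset i]%mset.

Lemma mcoeff_varM i (a : monom) (g : mpolys) :
  (mvar i * g)@_a = if (0 < a i)%N then g@_(mdel a i) else 0.
Proof.
case: ifP => ai.
  have {1}-> : a = mmul ([mset i]%mset : monom) (mdel a i).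
    apply/msetP => j; rewrite !msetE2 msetnE.
    by case: eqP => [->|] //; lia.
  exact: mcoeff_monomM.
rewrite mcoeffMl msuppU1 big_seq_fset1 big1_seq // => k _.
case: eqP => [h|_]; last by rewrite mulr0n.
have := congr1 (fun c : multiset nat => c i) h.
by rewrite msetE2 msetnxx => ka; rewrite -ka in ai.
Qed.

Definition sqfree N k (a : monom) : bool :=
  [&& all (fun i => (i < N)%N) (finsupp a),
      all (fun i => a i == 1%N) (finsupp a) & size (finsupp a) == k].

Lemma finsupp0P (a : monom) : (size (finsupp a) == 0%N) = (a == mset0).
Proof.
apply/idP/eqP => [|->]; last first.
  by rewrite cardfs_eq0; apply/eqP/fsetP => i; rewrite mem_finsupp mset0E inE.
rewrite cardfs_eq0 => /eqP h; apply/msetP => i; rewrite mset0E.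
by apply: fsfun_dflt; rewrite h.
Qed.

Lemma sqfreeS N k (a : monom) : (0 < a N)%N ->
  sqfree N.+1 k.+1 a = sqfree N k (mdel a N).
Proof.
move=> aN; set b := mdel _ _.
have bE i : b i = (a i - (i == N))%N.
  by rewrite /b /mdel msetE2 msetnE; case: eqP.
(* If the exponent of x_N is at least 2, then N still occurs after lowering it, and neither side is
   square-free in the required variables. *)
have [aN1|aN1] := eqVneq (a N) 1%N; last first.
  transitivity false.
    apply/negbTE/negP => /and3P[_ /allP/(_ N)]; rewrite mem_finsupp -lt0n aN.
    by move=> /(_ isT)/eqP h; rewrite h in aN1.
  symmetry; apply/negbTE/negP => /andP[/allP/(_ N)]; rewrite mem_finsupp bE eqxx.
  by rewrite -lt0n subn_gt0 /= ltn_neqAle eq_sym aN1 aN ltnn => /(_ isT).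
have pe : perm_eq (finsupp a) (N :: finsupp b).
  apply: uniq_perm; rewrite ?fset_uniq //= ?fset_uniq ?andbT.
    by rewrite mem_finsupp bE eqxx aN1.
  move=> i; rewrite inE !mem_finsupp bE.
  by have [->|_] := eqVneq i N; rewrite ?aN1 ?subn0.
have Nb : N \notin finsupp b by rewrite mem_finsupp bE eqxx aN1.
rewrite /sqfree !(perm_all _ pe) (perm_size pe) /= ltnSn aN1 /= eqSS.
congr [&& _, _ & _]; apply: eq_in_all => i ib.
  by rewrite ltnS leq_eqVlt; case: eqP ib => // ->; rewrite (negbTE Nb).
by rewrite bE; have [iN|_] := eqVneq i N; rewrite ?subn0 //; rewrite iN (negbTE Nb) in ib.
Qed.

Lemma mcoeff_elem_sym N k (a : monom) : (elem_sym mvar N k)@_a = (sqfree N k a)%:R.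
Proof.
elim: N k a => [|N IH] [|k] a.
- rewrite mcoeff1 -finsupp0P /sqfree; case: eqP => [/size0nil->|]; rewrite ?andbF //.
- rewrite /= mcoeff0 /sqfree; case: (finsupp a : seq nat) => [|i s] //=.
- rewrite mcoeff1 -finsupp0P /sqfree; case: eqP => [/size0nil->|]; rewrite ?andbF //.
rewrite /= mcoeffD mcoeff_varM !IH; case: ifP => aN.
  rewrite -sqfreeS // (_ : sqfree N _ _ = false) ?add0r //.
  by apply/negbTE/negP => /andP[/allP/(_ N)]; rewrite mem_finsupp -lt0n aN ltnn => /(_ isT).
rewrite addr0 /sqfree; congr ((_ && _)%:R); apply: eq_in_all => i.
rewrite mem_finsupp -lt0n ltnS [in RHS]leq_eqVlt.
by have [->|_] := eqVneq i N; rewrite ?aN.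
Qed.

Lemma elemE k (a : monom) : elem k a =
  (all (fun i => a i == 1%N) (finsupp a) && (size (finsupp a) == k))%:R.
Proof.
rewrite /elem /formal_sum.
have suppE (A : {fset nat}) : seq_mset (enum_fset A) = a -> A = finsupp a.
  move=> <-; apply/fsetP => i.
  by rewrite mem_finsupp mset_seqE -lt0n -has_count has_pred1.
have sqE : seq_mset (enum_fset (finsupp a)) = a <-> all (fun i => a i == 1%N) (finsupp a).
  split=> [h|/allP h].
    apply/allP => i ia; rewrite -h mset_seqE count_uniq_mem ?fset_uniq //.
    by rewrite ia.
  apply/msetP => i; rewrite mset_seqE count_uniq_mem ?fset_uniq //.
  have [ia|ia] := boolP (i \in finsupp a); first by rewrite (eqP (h _ ia)).
  by rewrite (fsfun_dflt ia).
case: (boolP (_ && _)) => [/andP[/sqE h /eqP sk]|h].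
  rewrite (_ : _ `&` _ = [set finsupp a]) ?fsbig_set1 //.
  apply/seteqP; split=> [A [_ /suppE->]//|A ->]; split=> //=.
rewrite (_ : _ `&` _ = set0) ?fsbig_set0 //.
apply/seteqP; split=> // A /= [Ak Aa]; move: h; rewrite -(suppE A Aa).
move/negP; apply; rewrite {1}(suppE A Aa) -Ak eqxx andbT; apply/sqE.
by rewrite -(suppE A Aa).
Qed.

(* Finitely many variables suffice to compute a coefficient, so the product of
   series can be computed in the monoid algebra. *)
Definition agree N (f : series) (g : mpolys) :=
  forall a : monom, all (fun i => (i < N)%N) (finsupp a) -> f a = g@_a.

Lemma agree_elem N k : agree N (elem k) (elem_sym mvar N k).
Proof. by move=> a aN; rewrite elemE mcoeff_elem_sym /sqfree aN. Qed.

Lemma agree_one N : agree N series_one 1.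
Proof. by move=> a _; rewrite mcoeff1. Qed.

(** The factors of a monomial in the first N variables involve only these variables, so the
    hypotheses apply to every splitting. *)
Lemma agree_mul N f1 f2 g1 g2 : agree N f1 g1 -> agree N f2 g2 ->
  agree N (series_mul f1 f2) (g1 * g2).
Proof.
move=> h1 h2 a aN; rewrite /series_mul.
set A := [set p : monom * monom | _].
have finA : finite_set A := finite_splittings a.
(* The supports are enlarged so that [d1] times [d2] contains every splitting of the monomial; the
   indicator in [F] removes all other pairs. *)
pose d1 := (msupp g1 `|` [fset p.1 | p in fset_set A])%fset.
pose d2 := (msupp g2 `|` [fset p.2 | p in fset_set A])%fset.
rewrite (@mcoeffMlw _ _ d1 d2) ?fsubsetUl //.
pose F (p : monom * monom) : {poly int} := (g1@_p.1 * g2@_p.2) *+ (mmul p.1 p.2 == a).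
transitivity (\sum_(p \in A) F p).
  apply: eq_fsbigr => p /set_mem pA.
  have pN i : i \in finsupp p.1 \/ i \in finsupp p.2 -> (i < N)%N.
    move=> ip; apply: (allP aN); rewrite mem_finsupp -pA msetE2.
    by case: ip; rewrite mem_finsupp -!lt0n addn_gt0 => ->; rewrite ?orbT.
  have -> : F p = g1@_p.1 * g2@_p.2.
    by rewrite /F; case: eqP => // /(_ pA).
  by congr (_ * _); [apply: h1 | apply: h2]; apply/allP => i ip; apply: pN; [left|right].
transitivity (\sum_(p \in [set` d1] `*` [set` d2]) F p).
  apply: fsbig_widen => [p pA|p [_ /= pA]].
    by split; rewrite /= in_fsetU; apply/orP; right; apply/imfsetP; exists p => //=;
      rewrite in_fset_set // inE.
  by rewrite /F; case: eqP => [h|//]; case: pA.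
rewrite -(pair_fsbig _ (fun k1 k2 => (g1@_k1 * g2@_k2) *+ (mmul k1 k2 == a))) //.
rewrite -fsbig_seq ?fset_uniq //; apply: eq_bigr => k1 _.
by rewrite -fsbig_seq ?fset_uniq.
Qed.

Lemma agree_elem_part N la :
  agree N (elem_part la) (\prod_(k <- la) elem_sym mvar N k).
Proof.
elim: la => [|k la IH]; first by rewrite big_nil; apply: agree_one.
by rewrite big_cons; apply: agree_mul => //; apply: agree_elem.
Qed.

Lemma monomU_mul (u v : monom) : << u >> * << v >> = << mmul u v >> :> mpolys.
Proof.
apply/malgP => k; rewrite mcoeffMl !msuppU1 !big_seq_fset1 !mcoeffUU mulr1.
by rewrite mcoeffU1.
Qed.

Lemma prod_mvar (I : Type) (r : seq I) (f : I -> nat) :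
  \prod_(i <- r) mvar (f i) = << (seq_mset [seq f i | i <- r] : monom) >>.
Proof.
elim: r => [|i r IH].
  rewrite big_nil; have -> : (seq_mset [seq f i | i <- [::]] : monom) = mone.
    by apply/msetP => j; rewrite mset_seqE mset0E.
  by [].
rewrite big_cons IH monomU_mul.
apply: (congr1 (fun u : monom => << u >> : mpolys)); apply/msetP => j.
by rewrite msetE2 !mset_seqE msetnE /= eq_sym; case: eqP.
Qed.

(** * Comparison of coefficients and grouping by cycle type *)

Section Main.
Variables (n : nat) (m : 'I_n -> 'I_n).
Hypothesis hm : Hessenberg m.
Local Notation G := (indiff_graph m).
Local Notation q := (malgC ('X : {poly int}) : mpolys).

Lemma ascE (kappa : 'I_n -> nat) : asc G kappa =
  (\sum_(i in [set: 'I_n]%SET) \sum_(j in [set: 'I_n]%SET)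
     (asc_edge m i j && (kappa i < kappa j)%N))%N.
Proof.
rewrite /asc cardsE -sum1_card big_mkcond /=.
rewrite (eq_bigr (fun p : 'I_n * 'I_n =>
  (asc_edge m p.1 p.2 && (kappa p.1 < kappa p.2)%N : nat))); last first.
  move=> [i j] _; rewrite unfold_in /= /indiff_graph /asc_edge.
  by case: (kappa _ < _)%N; case: (ltngtP i j) => //= _; case: (_ <= _)%N.
rewrite -(pair_bigA _ (fun i j : 'I_n => (asc_edge m i j && (kappa i < kappa j)%N : nat))) /=.
by apply: eq_big => [i|i _]; rewrite ?inE //; apply: eq_bigl => j; rewrite inE.
Qed.

(** A coloring with monomial [a] uses only variables of [a], hence only colors below N. The shift by
    one, which reserves 0 for uncolored vertices, preserves ascents. *)
Lemma LLT_color_sum N (a : monom) : all (fun i => (i < N)%N) (finsupp a) ->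
  LLT G a = (color_sum m q mvar N [set: 'I_n]%SET)@_a.
Proof.
move=> aN; rewrite /LLT /formal_sum setTI /color_sum raddf_sum /=.
pose h (k : {ffun 'I_n -> 'I_N.+1}) : {ffun 'I_n -> nat} := [ffun i => (k i).-1].
pose P := [pred k : {ffun 'I_n -> 'I_N.+1} | [forall i, k i != ord0] &&
   (seq_mset (codom (h k)) == a)].
transitivity (\sum_(k : {ffun 'I_n -> 'I_N.+1} | P k) 'X^(asc G (h k)) : {poly int}).
  rewrite (bigfs _ (index_enum_uniq _)); last by move=> k _; rewrite mem_index_enum.
  apply: reindex_fsbig; split.
  - by move=> k /= /andP[_ /eqP].
  - move=> k1 k2; rewrite !inE /= => /andP[/forallP k1n _] /andP[/forallP k2n _] h12.
    apply/ffunP => i; apply/val_inj.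
    have := congr1 (fun f : {ffun 'I_n -> nat} => f i) h12; rewrite !ffunE.
    move: (k1n i) (k2n i); rewrite -!val_eqE /= -!lt0n => i1 i2 hi.
    by rewrite -(prednK i1) -(prednK i2) hi.
  move=> k /= ka.
  have kN i : (k i < N)%N.
    apply: (allP aN); rewrite -ka mem_finsupp mset_seqE -lt0n -has_count has_pred1.
    exact: codom_f.
  pose k' : {ffun 'I_n -> 'I_N.+1} := [ffun i => lift ord0 (Ordinal (kN i))].
  have hk' : h k' = k by apply/ffunP => i; rewrite !ffunE.
  exists k'; last exact: hk'.
  apply/andP; split; last by rewrite hk' ka.
  by apply/forallP => i; rewrite ffunE.
rewrite [LHS]big_mkcondr /=; apply: eq_big => [k|k /forallP k0].
  by apply: eq_forallb => i; rewrite finset.in_setT eqb_id.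
have -> : \prod_(i in [set: 'I_n]%SET) mvar (k i).-1 = << (seq_mset (codom (h k)) : monom) >>.
  rewrite (eq_bigl predT) => [|i]; last by rewrite finset.in_setT.
  rewrite -big_enum /= (prod_mvar _ (fun i : 'I_n => (k i).-1)).
  apply: (congr1 (fun u : monom => << u >> : mpolys)); congr seq_mset.
  by rewrite codomE; apply: eq_map => i; rewrite ffunE.
rewrite -rmorphXn mcoeffCM mcoeffU1 ascE.
have -> : color_asc m [set: 'I_n]%SET k = (\sum_(i in [set: 'I_n]%SET)
    \sum_(j in [set: 'I_n]%SET) (asc_edge m i j && (h k i < h k j)%N))%N.
  apply: eq_bigr => i _; apply: eq_bigr => j _; rewrite !ffunE.
  have kp l : (0 < k l)%N by have := k0 l; rewrite -val_eqE -lt0n.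
  by rewrite -[((k i).-1 < _)%N]ltnS !prednK.
by case: eqP; rewrite ?mulr1 ?mulr0.
Qed.

Lemma LLT_cycle_expansion : LLT G =
  \sum_(s : 'S_n | perm_le s m)
     (('X - 1) ^+ (n - size (cycle_type s)) * 'X^(wt G s))
       *: elem_part (cycle_type s).
Proof.
case: (hm) => m_mono m_ge; apply/funext => a; rewrite fct_sumE.
(* N exceeds all variables of the chosen monomial, so its coefficient is computed with finitely many
   colors. *)
pose N := (\max_(i <- finsupp a) i).+1.
have aN : all (fun i => (i < N)%N) (finsupp a).
  by apply/allP => i ia; rewrite ltnS leq_bigmax_seq.
rewrite (LLT_color_sum aN) -perm_sum_elem_sym // /perm_sum raddf_sum /=.
apply: eq_big => [s|s _].
  rewrite (_ : perm_on _ _) /=; last by apply/fintype.subsetP => i _; rewrite finset.in_setT.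
  apply/forall_inP/forallP => h i; first by apply: h; rewrite finset.in_setT.
  by move=> _; apply: h.
rewrite perm_wtE.
have -> j k : (q - 1) ^+ j * q ^+ k = malgC (('X - 1) ^+ j * 'X^k) :> mpolys.
  by rewrite rmorphM !rmorphXn rmorphB rmorph1.
rewrite mcoeffCM.
by rewrite -(agree_elem_part _ aN).
Qed.

Lemma LLT_partition_expansion : LLT G =
  \sum_(la \in [set la | is_partition n la])
     (('X - 1) ^+ (n - size la) * c_coef m la) *: elem_part la.
Proof.
rewrite LLT_cycle_expansion fsbig_finite; last exact: finite_partitions.
set S := fset_set _.
under [RHS]eq_bigr do rewrite /c_coef mulr_sumr scaler_suml.
rewrite (exchange_big_dep (fun s : 'S_n => perm_le s m)) /=; last first.
  by move=> la s _ /andP[].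
apply: eq_bigr => s sm; rewrite sm /=.
rewrite -big_filter (_ : [seq la <- S | cycle_type s == la] = [:: cycle_type s]).
  by rewrite big_seq1.
rewrite (eq_filter (a2 := pred1 (cycle_type s))); last by move=> la /=; rewrite eq_sym.
apply: filter_pred1_uniq; first exact: fset_uniq.
rewrite in_fset_set ?inE /=; first exact: cycle_type_partition.
exact: finite_partitions.
Qed.

Lemma c_coef_nat la : c_coef m la \is a polyOver Num.nat.
Proof.
apply/polyOverP => i; rewrite coef_sum.
by under eq_bigr do rewrite coefXn; rewrite -natr_sum Num.Theory.natr_nat.
Qed.

End Main.

Theorem theorem1p2 (n : nat) (m : 'I_n -> 'I_n) (hm : Hessenberg m) :
  let G := indiff_graph m in
  [/\ LLT G =
        \sum_(s : 'S_n | perm_le s m)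
           (('X - 1) ^+ (n - size (cycle_type s)) * 'X^(wt G s))
             *: elem_part (cycle_type s),
      LLT G =
        \sum_(la \in [set la | is_partition n la])
           (('X - 1) ^+ (n - size la) * c_coef m la) *: elem_part la
    & forall la : seq nat, is_partition n la ->
        c_coef m la \is a polyOver Num.nat].
Proof.
split.
- exact: LLT_cycle_expansion.
- exact: LLT_partition_expansion.
by move=> la _; apply: c_coef_nat.
Qed.
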